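(* The $(\varepsilon,I_\bullet,J_\circ)$-lattice is isomorphic to an interval of the $\varepsilon$-Cambrian lattice.
   Context: Fix an integer $n\ge1$ and $\varepsilon\in\{+,-\}^n$. Black vertices are $0_\bullet,\dots,n_\bullet$, white vertices $1_\circ,\dots,(n+1)_\circ$, compared through their integer indices. Let $P_\varepsilon$ be a convex $(2n+2)$-gon in $\mathbb{R}^2$ whose vertices, in strictly increasing $x$-order, are $0_\bullet,1_\circ,1_\bullet,\dots,n_\circ,n_\bullet,(n+1)_\circ$, with $k_\circ,k_\bullet$ strictly above the line through $0_\bullet$ and $(n+1)_\circ$ if $\varepsilon_k=+$ and strictly below if $\varepsilon_k=-$ ($1\le k\le n$). Let $I_\bullet\subseteq\{0_\bullet,\dots,n_\bullet\}$, $J_\circ\subseteq\{1_\circ,\dots,(n+1)_\circ\}$ be nonempty with $\min(I_\bullet)<\min(J_\circ)$ and $\max(I_\bullet)<\max(J_\circ)$. Let $G$ be the geometric graph on $I_\bullet\cup J_\circ$ with a straight edge $(i_\bullet,j_\circ)$ for each $i_\bullet\in I_\bullet,j_\circ\in J_\circ$ with $i<j$; two edges cross if they meet at a point interior to both. An $(\varepsilon,I_\bullet,J_\circ)$-tree is an inclusion-maximal set of pairwise non-crossing edges of $G$. There is an increasing flip from a tree $T$ to a tree $T'$ if $T\setminus\{e\}=T'\setminus\{e'\}$ with $e\neq e'$ and the slope of $e$ smaller than that of $e'$. The $(\varepsilon,I_\bullet,J_\circ)$-lattice is the set of $(\varepsilon,I_\bullet,J_\circ)$-trees ordered by the reflexive-transitive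 closure of the increasing flip relation. Let $P^\square_\varepsilon$ be a convex $(n+2)$-gon with vertices $0_\square,\dots,(n+1)_\square$ in strictly increasing $x$-order, $k_\square$ strictly above the segment $[0_\square,(n+1)_\square]$ iff $\varepsilon_k=+$ (strictly below otherwise). Its triangulations are the inclusion-maximal sets of pairwise non-crossing segments between its vertices; there is an increasing flip from triangulation $T$ to $T'$ if $T\setminus\{\delta\}=T'\setminus\{\delta'\}$, $\delta\ne\delta'$, with slope of $\delta$ smaller than slope of $\delta'$. The $\varepsilon$-Cambrian lattice is the set of triangulations of $P^\square_\varepsilon$ ordered by the reflexive-transitive closure of this increasing flip relation (it is known to be a lattice). An interval of a poset is a set of the form $\{x: a\le x\le b\}$ with the induced order. *)

(* Defs.v *)
From mathcomp Require Import all_boot all_order all_algebra.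
From mathcomp Require Import boolp reals.

Set Implicit Arguments.
Unset Strict Implicit.
Unset Printing Implicit Defensive.
Import Order.TTheory GRing.Theory Num.Theory.
Local Open Scope ring_scope.

Section Plane.
Variable R : realType.
Implicit Types a b c d z : R * R.

Definition slope a b : R := (b.2 - a.2) / (b.1 - a.1).

(* Only meaningful for a non-vertical line, [a.1 != b.1]. *)
Definition above_line a b z : bool := a.2 + slope a b * (z.1 - a.1) < z.2.
Definition below_line a b z : bool := z.2 < a.2 + slope a b * (z.1 - a.1).

Definition segment_interior a b z : Prop :=
  exists t : R, [/\ 0 < t < 1,
    z.1 = (1 - t) * a.1 + t * b.1 & z.2 = (1 - t) * a.2 + t * b.2].

Definition segments_cross a b c d : Prop :=
  exists z, segment_interior a b z /\ segment_interior c d z.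

End Plane.

(* The points [p v] are the vertices of a convex #|V|-gon: none of them is a
   convex combination of the others. *)
Definition convex_polygon (R : realType) (V : finType) (p : V -> R * R) : Prop :=
  forall (v : V) (c : V -> R),
    (forall u, 0 <= c u) -> \sum_u c u = 1 -> c v = 0 ->
    ~ (\sum_u c u * (p u).1 = (p v).1 /\ \sum_u c u * (p u).2 = (p v).2).

(* A geometric graph is a vertex placement [p] together with a set [E] of
   edges.  An undirected edge is encoded by the pair of its endpoints, once;
   in the two graphs below it is oriented from left to right. *)
Section GeometricGraph.
Variables (R : realType) (V : finType) (p : V -> R * R) (E : {set V * V}).

Definition edge_slope (e : V * V) : R := slope (p e.1) (p e.2).

Definition edges_cross (e f : V * V) : Prop :=
  segments_cross (p e.1) (p e.2) (p f.1) (p f.2).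

(* Distinctness is required because an edge meets itself in its interior. *)
Definition noncrossing (T : {set V * V}) : Prop :=
  {in T &, forall e f, e != f -> ~ edges_cross e f}.

Definition max_noncrossing : pred {set V * V} :=
  maxset (fun T : {set V * V} => (T \subset E) && `[< noncrossing T >]).

Definition mnc : finType := {T : {set V * V} | max_noncrossing T}.

Definition increasing_flip : rel mnc := fun T T' =>
  [exists e in val T, exists e' in val T',
    [&& e != e', val T :\ e == val T' :\ e' & edge_slope e < edge_slope e']].

(* [connect] is the reflexive-transitive closure. *)
Definition flip_le : rel mnc := connect increasing_flip.

End GeometricGraph.

Section Polygons.
Variable n : nat.

(* [inl k] is the black vertex k and [inr k] is the white vertex k + 1. *)
Definition vertex : finType := ('I_n.+1 + 'I_n.+1)%type.

Definition black_vertices : {set vertex} := [set inl i | i : 'I_n.+1].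
Definition white_vertices : {set vertex} := [set inr j | j : 'I_n.+1].

Definition label (v : vertex) : nat :=
  match v with inl k => k | inr k => k.+1 end.

(* The position of a vertex in the sequence
   black 0, white 1, black 1, ..., white n, black n, white n+1. *)
Definition rank (v : vertex) : nat :=
  match v with inl k => k.*2 | inr k => k.*2.+1 end.

(* All labels are at most n + 1, so the default value is harmless when [A] is
   nonempty. *)
Definition min_label (A : {set vertex}) : nat :=
  \big[minn/n.+1]_(v in A) label v.
Definition max_label (A : {set vertex}) : nat := \max_(v in A) label v.

Variable R : realType.

(* [eps k] is the sign of index k + 1, with [true] for + and [false] for -. *)
Variable eps : 'I_n -> bool.

Definition is_P_polygon (p : vertex -> R * R) : Prop :=
  [/\ convex_polygon p,
      forall u v : vertex, (rank u < rank v)%N -> (p u).1 < (p v).1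
    & forall (k : 'I_n) (v : vertex), label v = k.+1 ->
        let side := if eps k then @above_line R else @below_line R in
        side (p (inl ord0)) (p (inr ord_max)) (p v)].

Definition is_square_polygon (q : 'I_n.+2 -> R * R) : Prop :=
  [/\ convex_polygon q,
      forall u v : 'I_n.+2, (u < v)%N -> (q u).1 < (q v).1
    & forall (k : 'I_n) (v : 'I_n.+2), v = k.+1 :> nat ->
        let side := if eps k then @above_line R else @below_line R in
        side (q ord0) (q ord_max) (q v)].

Definition tree_edges (I J : {set vertex}) : {set vertex * vertex} :=
  [set e | [&& e.1 \in I, e.2 \in J & (label e.1 < label e.2)%N]].

Definition polygon_edges : {set 'I_n.+2 * 'I_n.+2} :=
  [set e : 'I_n.+2 * 'I_n.+2 | (e.1 < e.2)%N].

Definition tree (p : vertex -> R * R) (I J : {set vertex}) : finType :=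
  mnc p (tree_edges I J).
Definition tree_le (p : vertex -> R * R) (I J : {set vertex}) :
  rel (tree p I J) := @flip_le R vertex p (tree_edges I J).

Definition triangulation (q : 'I_n.+2 -> R * R) : finType := mnc q polygon_edges.
Definition cambrian_le (q : 'I_n.+2 -> R * R) : rel (triangulation q) :=
  @flip_le R 'I_n.+2 q polygon_edges.

End Polygons.

(* The ordered type (A, leA) is isomorphic to an interval of (B, leB). *)
Definition isomorphic_to_interval (A B : Type) (leA : rel A) (leB : rel B) :
    Prop :=
  exists (a b : B) (f : A -> {z : B | leB a z && leB z b}),
    bijective f /\ {mono f : x y / leA x y >-> leB (val x) (val y)}.

(* Main.v *)
Require Import Defs.
From mathcomp Require Import all_boot all_order all_algebra zify ring lra.
From mathcomp Require Import boolp reals.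

Set Implicit Arguments.
Unset Strict Implicit.
Unset Printing Implicit Defensive.
Import Order.TTheory GRing.Theory Num.Theory.

(* Whether two edges cross, and which of them is then steeper, depends only on
   labels and signs: [cross_up a b c d] says that [(a, b)] and [(c, d)] cross and
   [(c, d)] has the larger slope.  If a family F of edges is closed under
   uncrossing, (i, j), (i', j') crossing => (i, j') in F, then every maximal
   noncrossing subset of F that contains an edge crossed by a less steep edge of F
   admits a decreasing flip; so the flip order on these subsets has a least and a
   greatest element, the sets of edges that are less (more) steep than all the
   edges of F they cross.

   Trees are turned into sets of diagonals by sending the edge (i, j) to (i, j),
   except that i is first replaced by the previous label m on the same side of the
   polygon when m occurs only in J and i only in I.  The images form such a family
   F.  Add to each image one fixed maximal noncrossing set C of diagonals crossing
   nothing in F, chosen to contain the sides of the convex hull of the vertices in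
   use: the results are triangulations, and flips of trees are flips of these.
   Increasing flips preserve the property that no edge crosses a given edge with a
   smaller slope.  A diagonal outside F and C either
   crosses C, or is crossed by an edge of the greatest tree that is less steep, or
   by an edge of the least tree that is steeper; hence it occurs in no
   triangulation between the two extreme ones, and every triangulation between
   these comes from a tree. *)

(** * Crossings in terms of labels and signs *)

Section Crossing.
(* [s k] is [true] when the vertices labelled [k] lie on the upper side. *)
Variable s : nat -> bool.

(* For overlapping edges [(a, b)] and [(c, d)], at the rightmost of the abscissae
   of [a] and [c] the edge [(a, b)] is above [(c, d)] iff [above_l a c], and at the
   leftmost of those of [b] and [d] it is below [(c, d)] iff [below_r b d]. *)
Definition above_l a c := if s a then ~~ s c || (c < a) else ~~ s c && (a < c).
Definition below_r b d := if s d then ~~ s b || (d < b) else ~~ s b && (b < d).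
Definition cross_up a b c d := [&& c < b, a < d, above_l a c & below_r b d].
Definition cross a b c d := cross_up a b c d || cross_up c d a b.

Ltac crush := rewrite /cross /cross_up /above_l /below_r /=;
  repeat match goal with |- context [s ?x] => case: (s x);
    rewrite /= ?andbF ?orbF ?andbT //= end; lia.

(** The edge [(i', j)] and the parts of the two crossing edges from [i'] and [j] to their common
    point bound a triangle without vertices inside; an edge that enters it through [(i', j)] leaves
    through another side. *)
Lemma cross_corner i j i' j' x y : i < j -> i' < j' -> x < y ->
  cross i j i' j' -> cross x y i' j -> cross x y i j || cross x y i' j'.
Proof. crush. Qed.

(** The same triangles, now keeping track of slopes. This serves flips that replace [(i, j)] by
    [(i', j')] while both corner edges are present, see [flip_keeps_above]. *)
Lemma cross_up_corner i j i' j' a b : i < j -> i' < j' -> a < b ->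
  cross_up i j i' j' -> cross_up i' j' a b ->
    [|| cross_up i j a b, cross_up i' j a b | cross_up i j' a b].
Proof. crush. Qed.

(** Both relations are strict linear orders along the boundary. From the highest label to the
    lowest, [above_l] runs counterclockwise from the right end and [below_r] runs clockwise from the
    left end. *)
Lemma above_l_trans b a c : above_l a b -> above_l b c -> above_l a c.
Proof. rewrite /above_l; case: (s a) (s b) (s c) => [] [] [] //=; lia. Qed.

Lemma below_r_trans b a c : below_r a b -> below_r b c -> below_r a c.
Proof. rewrite /below_r; case: (s a) (s b) (s c) => [] [] [] //=; lia. Qed.

Lemma above_l_total a b : [|| a == b, above_l a b | above_l b a].
Proof.
by rewrite /above_l; case: (ltngtP a b) => // _; case: (s a) (s b) => [] [].
Qed.

Lemma below_r_total a b : [|| a == b, below_r a b | below_r b a].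
Proof.
by rewrite /below_r; case: (ltngtP a b) => // _; case: (s a) (s b) => [] [].
Qed.

Lemma crossC a b c d : cross a b c d = cross c d a b.
Proof. by rewrite /cross orbC. Qed.

(** A label on the upper side is above all smaller labels and one on the lower side is below all of
    them, so no smaller labels lie both above and below it. *)
Lemma above_l_mid a i i' : above_l i' a -> above_l a i -> i < a -> i' < a -> False.
Proof. rewrite /above_l; case: (s a) (s i) (s i') => [] [] [] //=; lia. Qed.

Lemma below_r_mid b j j' : below_r j' b -> below_r b j -> b < j -> b < j' -> False.
Proof. rewrite /below_r; case: (s b) (s j) (s j') => [] [] [] //=; lia. Qed.

Lemma ncross_far a b c d : ~~ cross a b c d -> above_l a c -> below_r b d ->
  (b <= c) || (d <= a).
Proof.
rewrite /cross /cross_up /= => + H1 H2; rewrite H1 H2 !andbT negb_or => /andP[] + _.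
by rewrite negb_and -!leqNgt.
Qed.

(** The common point cuts [(i, j)] into two halves. The half at [i] bounds a triangle with [(i, j')]
    and a part of [(i', j')], so an edge through it that crosses neither must end at [j']. Likewise
    the half at [j] forces the edge to start at [i']. *)
Lemma swap_maximal_up i j i' j' x y : i < j -> i' < j' -> x < y ->
  cross_up i j i' j' -> cross x y i j -> ~~ cross x y i' j' -> ~~ cross x y i' j ->
    ~~ cross x y i j' ->
  [|| (x == i') && (y == j'),
    (y == j') && cross x j i' j' | (x == i') && cross i y i' j'].
Proof.
move=> ij ij' xy /and4P[/= o1 o2 Li Rj].
case/orP => /and4P[/= o3 o4 L R] n1 n2 n3.
- have L' := above_l_trans L Li; have R' := below_r_trans R Rj.
  have := ncross_far n1 L' R'; have := ncross_far n2 L' R;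
    have := ncross_far n3 L R'.
  clear -ij ij' xy o3 o4; lia.
- rewrite crossC in n2; rewrite crossC in n3.
  case/or3P: (above_l_total x i') => E1.
  + move/eqP in E1; subst x; rewrite eqxx /=.
    case/or3P: (below_r_total y j') => E2; first by rewrite E2.
    * by rewrite /cross /cross_up /= E2 Li xy o2 !orbT.
    * have := ncross_far n3 L E2; clear -ij' o4; lia.
  + case/or3P: (below_r_total y j') => E2.
    * by rewrite /cross /cross_up E2 /= E1 Rj -(eqP E2) xy o1 !orbT.
    * have := ncross_far n1 E1 E2; have := below_r_mid R E2;
        have := above_l_mid L E1; clear -ij ij' o1 o2; lia.
    * have := ncross_far n3 L E2; have := above_l_mid L E1; clear -o4 ij' o2; lia.
  + have N2 := ncross_far n2 E1 R; case/or3P: (below_r_total y j') => E2.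
    * move: N2; rewrite (eqP E2); clear -o3 ij'; lia.
    * have := below_r_mid R E2; move: N2; clear -o3 o1 ij'; lia.
    * have := ncross_far n3 L E2; move: N2; clear -ij' xy o3 o4; lia.
Qed.

(** Each alternative is a corner of [(i', j')] with [(i, j)] or [(a, b)] that still crosses one of
    these two with smaller slope. This feeds the induction in [down_flip]. *)
Lemma cross_descent i j i' j' a b : i < j -> i' < j' -> a < b ->
  cross_up i' j' i j -> cross a b i' j' -> ~~ cross a b i j ->
    (a != i) || (b != j) ->
  [|| cross_up a j' i j, cross_up i' j a b, cross_up i' b i j | cross_up i j' a b].
Proof.
move=> ij ij' ab /and4P[/= o1 o2 Li Rj].
case/orP => /and4P[/= o3 o4 L R] n1.
- have L' := above_l_trans L Li; have R' := below_r_trans R Rj.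
  have := ncross_far n1 L' R'; rewrite /cross_up /= L' R' Li Rj;
    clear -ij ij' ab o1 o2 o3 o4; lia.
- rewrite /cross_up /= L R Rj Li o1 o2 o3 o4 /= ?andbT.
  case/or3P: (above_l_total a i) => E1; case/or3P: (below_r_total b j) => E2;
    rewrite ?E1 ?E2 ?(eqP E1) ?(eqP E2) ?eqxx ?ij //=; move: ab;
      rewrite ?(eqP E1) ?(eqP E2) => ab _; rewrite ?ab ?ij ?orbT //.
  all: try have:= above_l_mid L E1; try have := below_r_mid R E2;
    clear -ij ij' ab o1 o2 o3 o4; lia.
Qed.
End Crossing.

(** Negating all signs reflects the polygon in a horizontal line, which keeps crossings and reverses
    the comparison of slopes. *)
Lemma cross_upN s a b c d : cross_up (negb \o s) a b c d = cross_up s c d a b.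
Proof.
rewrite /cross_up /above_l /below_r /=;
  case: (s a) (s b) (s c) (s d) => [] [] [] [] //=;
  by rewrite ?andbF ?andbT //; case: (_ < _); case: (_ < _).
Qed.

Lemma crossN s a b c d : cross (negb \o s) a b c d = cross s a b c d.
Proof. by rewrite /cross !cross_upN orbC. Qed.

Lemma swap_maximal s i j i' j' x y : i < j -> i' < j' -> x < y ->
  cross s i j i' j' -> cross s x y i j -> ~~ cross s x y i' j' ->
    ~~ cross s x y i' j ->
  ~~ cross s x y i j' ->
  [|| (x == i') && (y == j'), (y == j') && cross s x j i' j'
    | (x == i') && cross s i y i' j'].
Proof.
move=> ij ij' xy /orP[u|u]; first exact: swap_maximal_up.
by rewrite -!(crossN s); apply: swap_maximal_up; rewrite // cross_upN.
Qed.

(** * Flips of maximal noncrossing sets *)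

Section EdgeSets.
Variables (n : nat) (s : nat -> bool).
Notation W := ('I_n.+2 * 'I_n.+2)%type.
Implicit Types (e f g h : W) (F T t : {set W}).

Definition ecross_up e f := cross_up s e.1 e.2 f.1 f.2.
Definition ecross e f := cross s e.1 e.2 f.1 f.2.

Definition ncross T := [forall e in T, forall f in T, ~~ ecross e f].
Definition max_ncross F T := maxset (fun T => (T \subset F) && ncross T) T.
Definition up_flip T T' :=
  [exists e in T, exists e' in T',
    [&& e != e', T :\ e == T' :\ e' & ecross_up e e']].

Definition exchange F := {in F &, forall e f, ecross e f -> (e.1, f.2) \in F}.

Lemma ecrossC e f : ecross e f = ecross f e. Proof. exact: crossC. Qed.

Lemma above_lxx a : above_l s a a = false.
Proof. by rewrite /above_l ltnn; case: (s a). Qed.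

Lemma below_rxx a : below_r s a a = false.
Proof. by rewrite /below_r ltnn; case: (s a). Qed.

Lemma cross_left a b d : cross s a b a d = false.
Proof. by rewrite /cross /cross_up above_lxx !andbF. Qed.

Lemma cross_right a c b : cross s a b c b = false.
Proof. by rewrite /cross /cross_up below_rxx !andbF. Qed.

Lemma ecrossxx e : ecross e e = false. Proof. exact: cross_left. Qed.

Lemma ecross_upW e f : ecross_up e f -> ecross e f.
Proof. by move=> u; apply/orP; left. Qed.

Lemma above_l_asym a b : above_l s a b -> above_l s b a = false.
Proof. by move=> h; apply/negP => /(above_l_trans h); rewrite above_lxx. Qed.

Lemma ncrossP T : reflect {in T &, forall e f, ~~ ecross e f} (ncross T).
Proof.
apply: (iffP forall_inP) => H e.
  by move=> f eT fT; exact: (forall_inP (H e eT)).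
by move=> eT; apply/forall_inP => f; exact: H.
Qed.

Lemma max_ncrossP F T : reflect
  [/\ T \subset F, ncross T & {in F, forall g, {in T, forall f, ~~ ecross g f} ->
    g \in T}]
  (max_ncross F T).
Proof.
apply: (iffP maxsetP) => [[/andP[TF ncT] M]|[TF ncT M]].
  split=> // g gF gT; rewrite -(M (g |: T)) ?setU11 ?subsetUr //.
  rewrite subUset sub1set gF TF /=;
    apply/ncrossP => e f /setU1P[->|eT] /setU1P[->|fT].
  - by rewrite ecrossxx.
  - exact: gT.
  - by rewrite ecrossC; apply: gT.
  - exact: (ncrossP _ ncT).
split; first by rewrite TF.
move=> B /andP[BF ncB] TB; apply/eqP; rewrite eqEsubset TB andbT.
apply/subsetP => g gB; apply: M; first exact: (subsetP BF).
by move=> f fT; apply: (ncrossP _ ncB) => //; apply: (subsetP TB).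
Qed.

Lemma max_ncross_exists F T : T \subset F -> ncross T ->
  exists2 t, max_ncross F t & T \subset t.
Proof.
move=> TF ncT.
have [|t mt Tt] := @maxset_exists _ (fun T => (T \subset F) && ncross T) T.
  by rewrite TF.
by exists t.
Qed.

Lemma max_ncross_crossed F t g : max_ncross F t -> g \in F -> g \notin t ->
  exists2 f, f \in t & ecross g f.
Proof.
case/max_ncrossP => _ _ M gF gt.
have [/existsP[f /andP[ft c]]|/existsPn H] :=
    boolP [exists f, (f \in t) && ecross g f].
  by exists f.
by case/negP: gt; apply: M => // f ft; move: (H f); rewrite ft.
Qed.

Variable F : {set W}.
Hypothesis FE : F \subset polygon_edges n.
Hypothesis FX : exchange F.

Lemma F_lt e : e \in F -> e.1 < e.2.
Proof. by move/(subsetP FE); rewrite inE. Qed.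

Lemma ecross_corner e f h : e \in F -> f \in F -> h \in F ->
  ecross e f -> ecross h (f.1, e.2) -> ecross h e || ecross h f.
Proof. by move=> /F_lt e1 /F_lt f1 /F_lt h1; exact: cross_corner. Qed.

(** An edge of [t] crossing the corner edge would cross [e] or [e']. The first contradicts that [t]
    is noncrossing; the second forces it to be [e], which shares an endpoint with the corner.
    Maximality of [t] then applies. *)
Lemma max_ncross_corner t e e' : max_ncross F t -> e \in t -> e' \in F ->
  ecross e e' ->
  {in t, forall f, ecross f e' -> f = e} -> (e'.1, e.2) \in t.
Proof.
move=> mt et e'F cee' only; have /max_ncrossP[tF nct M] := mt.
have eF : e \in F by apply: (subsetP tF).
have gF : (e'.1, e.2) \in F by apply: FX => //; rewrite ecrossC.
apply: M => // f ft; apply/negP; rewrite ecrossC => c.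
have fF : f \in F by apply: (subsetP tF).
case/orP: (ecross_corner eF e'F fF cee' c); first by apply/negP/(ncrossP _ nct).
move=> /(only _ ft) fe; move: c; rewrite fe.
by rewrite /ecross cross_right.
Qed.

Lemma max_ncross_corner' t e e' : max_ncross F t -> e \in t -> e' \in F ->
  ecross e e' ->
  {in t, forall f, ecross f e' -> f = e} -> (e.1, e'.2) \in t.
Proof.
move=> mt et e'F cee' only; have /max_ncrossP[tF nct M] := mt.
have eF : e \in F by apply: (subsetP tF).
have gF : (e.1, e'.2) \in F by apply: FX.
apply: M => // f ft; apply/negP; rewrite ecrossC => c.
have fF : f \in F by apply: (subsetP tF).
rewrite ecrossC in cee'.
case/orP: (ecross_corner e'F eF fF cee' c); last by apply/negP/(ncrossP _ nct).
move=> /(only _ ft) fe; move: c; rewrite fe.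
by rewrite /ecross cross_left.
Qed.

(** Both corner edges lie in [t] and survive the swap. An edge [g] compatible with the new set but
    crossing [e] is thus restricted by [swap_maximal] to [e'] itself or to two shapes, each excluded
    by maximality of [t]. *)
Lemma max_ncross_swap t e e' : max_ncross F t -> e \in t -> e' \in F ->
  ecross e e' ->
  {in t, forall f, ecross f e' -> f = e} -> max_ncross F (e' |: t :\ e).
Proof.
move=> mt et e'F cee' only; have /max_ncrossP[tF nct M] := mt.
have eF : e \in F by apply: (subsetP tF).
have c1 := max_ncross_corner mt et e'F cee' only.
have c2 := max_ncross_corner' mt et e'F cee' only.
have ne1 : (e'.1, e.2) != e.
  by apply/eqP => H; move: cee'; rewrite -H /ecross cross_left.
have ne2 : (e.1, e'.2) != e.
  by apply/eqP => H; move: cee'; rewrite -H /ecross cross_right.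
apply/max_ncrossP; split.
- by rewrite subUset sub1set e'F (subset_trans _ tF) ?subD1set.
- have D f : f \in t :\ e -> ~~ ecross f e'.
    by case/setD1P => fe ft; apply/negP => /(only _ ft) H; rewrite H eqxx in fe.
  apply/ncrossP => f g /setU1P[->|ft] /setU1P[->|gt].
  + by rewrite ecrossxx.
  + by rewrite ecrossC D.
  + exact: D.
  + by case/setD1P: ft => _ ft; case/setD1P: gt => _ gt; apply: (ncrossP _ nct).
move=> g gF gn.
have [cge|cge] := boolP (ecross g e); last first.
  have gt : g \in t.
    apply: M => // f ft; have [->//|fe] := eqVneq f e.
    by apply: gn; rewrite in_setU1 in_setD1 fe ft orbT.
  rewrite in_setU1 in_setD1 gt andbT; apply/orP; right.
  by apply/eqP => H; move: (gn e'); rewrite H setU11 cee' => /(_ isT).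
have N1 : ~~ ecross g e' by apply: gn; rewrite setU11.
have N2 : ~~ ecross g (e'.1, e.2).
  by apply: gn; rewrite in_setU1 in_setD1 ne1 c1 orbT.
have N3 : ~~ ecross g (e.1, e'.2).
  by apply: gn; rewrite in_setU1 in_setD1 ne2 c2 orbT.
(* [k] crosses [e'] and is not [e], so it is missing from [t] and some [f] in [t] crosses it. By [H]
   this [f] crosses [e], its neighbour in [t], or [g], which is compatible with [f]. *)
have contra k : k \in F -> ecross k e' -> k != e ->
    (forall f, f \in t -> ecross f k -> ecross f g || ecross f e) ->
      ecross e k = false -> False.
  move=> kF ke' ke H eke.
  have kt : k \notin t by apply/negP => kt; rewrite (only _ kt ke') eqxx in ke.
  have [f ft kf] := max_ncross_crossed mt kF kt.
  have fe : f != e by apply/eqP => fe; rewrite -fe ecrossC kf in eke.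
  case/orP: (H f ft (etrans (ecrossC _ _) kf)); last by apply/negP/(ncrossP _ nct).
  by rewrite ecrossC; apply/negP/gn; rewrite in_setU1 in_setD1 fe ft orbT.
case/or3P: (swap_maximal (F_lt eF) (F_lt e'F) (F_lt gF) cee' cge N1 N2 N3).
- case/andP => /eqP/val_inj E1 /eqP/val_inj E2.
  by rewrite in_setU1; apply/orP; left;
    rewrite [g]surjective_pairing E1 E2 -surjective_pairing.
- case/andP => /eqP/val_inj E2 c; exfalso.
  apply: (contra (g.1, e.2)) => //.
  + exact: FX.
  + apply/eqP => H; move: cge; rewrite -H /ecross cross_left //.
  + move=> f ft; have fF := subsetP tF _ ft.
    by rewrite orbC; apply: ecross_corner => //; rewrite ecrossC.
  + exact: cross_right.
- case/andP => /eqP/val_inj E1 c; exfalso.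
  apply: (contra (e.1, g.2)) => //.
  + by apply: FX => //; rewrite ecrossC.
  + apply/eqP => H; move: cge; rewrite -H /ecross cross_right //.
  + move=> f ft; have fF := subsetP tF _ ft.
    by apply: ecross_corner.
  + exact: cross_left.
Qed.

(** An edge of [t] crossing the corner [g'] crosses [g] or [h], hence [g], because [h] is in [t].
    Moreover [h] crosses [g] but shares an endpoint with [g']. *)
Lemma crossing_lt t g h g' : max_ncross F t -> h \in t -> g \in F -> ecross h g ->
  g' = (h.1, g.2) \/ g' = (g.1, h.2) ->
  #|[set f in t | ecross f g']| < #|[set f in t | ecross f g]|.
Proof.
move=> mt ht gF hg E; have /max_ncrossP[tF nct _] := mt; have hF := subsetP tF _ ht.
have kg' : ecross h g' = false.
  by case: E => ->; [exact: cross_left|exact: cross_right].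
apply: (@leq_trans #|[set f in t | ecross f g] :\ h|.+1); last first.
  by rewrite [X in _ < X](cardsD1 h) !inE ht hg.
rewrite ltnS; apply/subset_leq_card/subsetP => f; rewrite !inE => /andP[ft fg'].
rewrite ft /=; apply/andP; split; first by apply/eqP => fh; rewrite fh kg' in fg'.
have fF := subsetP tF _ ft; have nfh : ~~ ecross f h by apply: (ncrossP _ nct).
have: ecross f h || ecross f g.
  case: E fg' => -> fg'; last exact: ecross_corner.
  by rewrite orbC; apply: ecross_corner => //; rewrite ecrossC.
by rewrite (negPf nfh).
Qed.

(* If [g] crosses another edge of [t] besides [e], it can be replaced by an edge
   sharing one endpoint with it and crossing fewer edges of [t]. *)
Lemma down_flip t e g : max_ncross F t -> e \in t -> g \in F -> ecross_up g e ->
  exists2 t', max_ncross F t' & up_flip t' t.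
Proof.
move=> mt; have /max_ncrossP[tF nct M] := mt.
have [m] := ubnP #|[set f in t | ecross f g]|.
elim: m g e => // m IH g e ltm et gF uge.
have eF := subsetP tF _ et.
have ceg : ecross e g by rewrite ecrossC ecross_upW.
have [/existsP[h /and3P[ht hge he]]|/existsPn only] :=
    boolP [exists h, [&& h \in t, ecross h g & h != e]].
  have hF := subsetP tF _ ht.
  have low h' g' e' : h' \in t -> ecross h' g ->
    g' = (h'.1, g.2) \/ g' = (g.1, h'.2) ->
      e' \in t -> ecross_up g' e' -> exists2 t', max_ncross F t' & up_flip t' t.
    move=> h't h'g E e't u; have h'F := subsetP tF _ h't.
    apply: (IH g' e') => //; last by case: E => ->; apply: FX => //;
      rewrite ecrossC.
    by rewrite -ltnS; apply: leq_trans ltm; rewrite ltnS; apply: crossing_lt h'g E.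
  have nhe : ~~ ecross h e by apply: (ncrossP _ nct).
  have dist : (h.1 != e.1 :> nat) || (h.2 != e.2 :> nat).
    by rewrite -negb_and;
      apply: contra he => /andP[/eqP/val_inj E1 /eqP/val_inj E2];
      rewrite [h]surjective_pairing E1 E2 -surjective_pairing.
  case/or4P: (cross_descent (F_lt eF) (F_lt gF) (F_lt hF) uge hge nhe dist) => u.
  + by apply: (low h (h.1, g.2) e) => //; left.
  + by apply: (low e (g.1, e.2) h) => //; right.
  + by apply: (low h (g.1, h.2) e) => //; right.
  + by apply: (low e (e.1, g.2) h) => //; left.
have only' : {in t, forall f, ecross f g -> f = e}.
  by move=> f ft fg; apply/eqP; move: (only f); rewrite ft fg negbK.
exists (g |: t :\ e); first exact: max_ncross_swap.
have gt : g \notin t.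
  by apply/negP => gt; case/negP: (ncrossP _ nct e g et gt).
apply/exists_inP; exists g; first by rewrite setU11.
apply/exists_inP; exists e => //; apply/and3P; split=> //.
  by apply: contraNneq gt => ->.
by rewrite setU1K // in_setD1 (negPf gt) andbF.
Qed.

Definition min_tree := [set e in F | [forall g in F, ~~ ecross_up g e]].

(** Otherwise [e'] would be compatible with all of [t] and belong to it by maximality. So the two
    exchanged edges always have comparable slopes in the sense of [ecross_up]. *)
Lemma up_flip_ecross t t' e e' : max_ncross F t -> max_ncross F t' -> e \in t ->
  e' \in t' ->
   t :\ e = t' :\ e' -> e != e' -> ecross e e'.
Proof.
move=> /max_ncrossP[tF nct M] /max_ncrossP[tF' nct' M'] et et' E ne;
  apply/negPn/negP => nee'.
have e't : e' \notin t.
  apply/negP => H; have: e' \in t :\ e by rewrite in_setD1 eq_sym ne H.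
  by rewrite E setD11.
case/negP: e't; apply: M => [|f ft]; first exact: (subsetP tF').
have [->|fe] := eqVneq f e; first by rewrite ecrossC.
have: f \in t' :\ e' by rewrite -E in_setD1 fe.
by case/setD1P => _ ft'; apply: (ncrossP _ nct').
Qed.

(** If the new edge [e'] crossed [c] with smaller slope, then by [cross_up_corner] so would [e] or
    one of the two corner edges, and all three lie in [t]. *)
Lemma flip_keeps_above t t' (c : W) : max_ncross F t -> max_ncross F t' ->
  up_flip t t' -> c.1 < c.2 ->
  {in t, forall f, ~~ ecross_up f c} -> {in t', forall f, ~~ ecross_up f c}.
Proof.
move=> mt mt' /exists_inP[e et /exists_inP[e' et' /and3P[ne /eqP E u]]] cc H f ft'.
have [fe|fe] := eqVneq f e'; last first.
  have: f \in t :\ e by rewrite E in_setD1 fe ft'.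
  by case/setD1P => _; apply: H.
rewrite {}fe {f ft'}.
have /max_ncrossP[tF nct _] := mt; have /max_ncrossP[tF' nct' _] := mt'.
have eF := subsetP tF _ et; have eF' := subsetP tF' _ et'.
have only : {in t, forall f, ecross f e' -> f = e}.
  move=> f ft c'; apply/eqP/negPn/negP => fe.
  have: f \in t' :\ e' by rewrite -E in_setD1 fe.
  by case/setD1P => _ ft'; move/negP: (ncrossP _ nct' f e' ft' et').
have c1 := max_ncross_corner mt et eF' (ecross_upW u) only.
have c2 := max_ncross_corner' mt et eF' (ecross_upW u) only.
apply/negP => uc.
by case/or3P: (cross_up_corner (F_lt eF) (F_lt eF') cc u uc); apply/negP;
  [apply: (H e)|apply: (H (_, _) c1)|apply: (H (_, _) c2)].
Qed.

Definition flip_in : rel {set W} :=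
  fun t t' => [&& max_ncross F t, max_ncross F t' & up_flip t t'].

Lemma ncross_min_tree : ncross min_tree.
Proof.
apply/ncrossP => e f;
  rewrite !inE => /andP[eF /forall_inP He] /andP[fF /forall_inP Hf].
by rewrite /ecross /cross negb_or (Hf e eF) (He f fF).
Qed.

Lemma connect_min_tree t : max_ncross F t ->
  max_ncross F min_tree /\ connect flip_in min_tree t.
Proof.
(* By [flip_keeps_above] a decreasing flip strictly enlarges [Lw t]. *)
pose Lw t := [set c in F | [exists f in t, ecross_up f c]].
have [m] := ubnP #|F :\: Lw t|.
elim: m t => // m IH t ltm mt; have /max_ncrossP[tF nct M] := mt.
have [sub|/subsetPn[e et]] := boolP (t \subset min_tree).
  suff -> : min_tree = t by split.
  apply/eqP; rewrite eqEsubset sub andbT; apply/subsetP => g gt.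
  apply: M => [|f ft]; first by move: gt; rewrite inE => /andP[].
  by apply: (ncrossP _ ncross_min_tree) => //; apply: (subsetP sub).
rewrite inE (subsetP tF _ et) /= negb_forall_in => /exists_inP[g gF].
rewrite negbK => uge; have [t' mt' fl] := down_flip mt et gF uge.
have [|//|m0 con] := IH t'; last first.
  split=> //; apply: connect_trans con (connect1 _); exact/and3P.
have LwS : Lw t \subset Lw t'.
  apply/subsetP => c; rewrite !inE => /andP[cF]; rewrite cF /=.
  apply: contraLR => /exists_inPn H; apply/exists_inPn => f ft.
  by apply: (flip_keeps_above mt' mt fl (F_lt cF)).
(* The edge [e2] removed by the decreasing flip makes the inclusion strict: [e1] in [t'] crosses it
   with smaller slope, whereas nothing in [t] crosses it. *)
have /exists_inP[e1 e1t /exists_inP[e2 e2t /and3P[_ _ u12]]] := fl.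
have e2F := subsetP tF _ e2t.
have in1 : e2 \in Lw t' by rewrite inE e2F; apply/exists_inP; exists e1.
have nin : e2 \notin Lw t.
  rewrite inE e2F /=; apply/exists_inPn => f ft.
  by apply/negP => /ecross_upW; apply/negP/(ncrossP _ nct).
rewrite -ltnS; apply: leq_trans ltm; rewrite ltnS; apply: proper_card.
apply/properP; split; first exact: setDS.
by exists e2; rewrite in_setD e2F ?nin // in1.
Qed.

Lemma max_ncross_min_tree : max_ncross F min_tree.
Proof.
have [|t mt _] := @max_ncross_exists F set0 (sub0set _).
  by apply/ncrossP => e f; rewrite inE.
by have [] := connect_min_tree mt.
Qed.

(** Start from any member of [G] and pass to a corner in [G] as long as an edge of [t] outside [G]
    crosses it. By [crossing_lt] fewer edges of [t] cross the new member, so the process ends in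
    [t]. *)
Lemma crossing_descent t (G : {set W}) : max_ncross F t -> G != set0 ->
  G \subset F ->
  {in G & t, forall g h, ecross g h ->
     [|| h \in G, (h.1, g.2) \in G | (g.1, h.2) \in G]} ->
  exists2 g, g \in t & g \in G.
Proof.
move=> mt /set0Pn[g gG] GF desc; have /max_ncrossP[tF nct M] := mt.
have [m] := ubnP #|[set f in t | ecross f g]|.
elim: m g gG => // m IH g gG ltm.
have gF := subsetP GF _ gG.
have [gt|gt] := boolP (g \in t); first by exists g.
have [h ht gh] := max_ncross_crossed mt gF gt; have hg := etrans (ecrossC _ _) gh.
have low := crossing_lt mt ht gF hg.
case/or3P: (desc g h gG ht gh) => H; first by exists h.
  by apply: (IH _ H); apply: leq_trans (low _ _) _; [left|].
by apply: (IH _ H); apply: leq_trans (low _ _) _; [right|].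
Qed.
End EdgeSets.

(** * Reflection and the greatest element *)

Section Duality.
Variables (n : nat) (s : nat -> bool).
Notation W := ('I_n.+2 * 'I_n.+2)%type.
Implicit Types (F T t : {set W}).

Lemma ecross_upN (e f : W) : ecross_up (negb \o s) e f = ecross_up s f e.
Proof. exact: cross_upN. Qed.

Lemma ecrossN (e f : W) : ecross (negb \o s) e f = ecross s e f.
Proof. exact: crossN. Qed.

Lemma ncrossN T : ncross (negb \o s) T = ncross s T.
Proof.
by apply: eq_forallb_in => e _; apply: eq_forallb_in => f _; rewrite ecrossN.
Qed.

Lemma max_ncrossN F T : max_ncross (negb \o s) F T = max_ncross s F T.
Proof. by apply: maxset_eq => A; rewrite ncrossN. Qed.

Lemma exchangeN F : exchange s F -> exchange (negb \o s) F.
Proof. by move=> FX e f eF fF; rewrite ecrossN; apply: FX. Qed.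

Lemma up_flipN T T' : up_flip (negb \o s) T T' = up_flip s T' T.
Proof.
apply/exists_inP/exists_inP => -[e eT /exists_inP[f fT /and3P[ef /eqP E u]]];
  exists f => //; apply/exists_inP; exists e => //;
  by rewrite eq_sym ef E eqxx /= ?ecross_upN // -ecross_upN.
Qed.

Lemma flip_inN F T T' : flip_in (negb \o s) F T T' = flip_in s F T' T.
Proof. by rewrite /flip_in !max_ncrossN up_flipN andbCA. Qed.

Lemma connectN F T T' :
  connect (flip_in (negb \o s) F) T T' = connect (flip_in s F) T' T.
Proof.
rewrite -[RHS](connect_rev (flip_in s F) T T'); apply: eq_connect => x y.
exact: flip_inN.
Qed.

Definition max_tree F := [set e in F | [forall g in F, ~~ ecross_up s e g]].

Lemma min_treeN F : min_tree (negb \o s) F = max_tree F.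
Proof.
apply/setP => e; rewrite !inE; congr andb; apply/eq_forallb_in => g _.
by rewrite ecross_upN.
Qed.

Variable F : {set W}.
Hypothesis FE : F \subset polygon_edges n.
Hypothesis FX : exchange s F.

Lemma connect_max_tree t : max_ncross s F t -> connect (flip_in s F) t (max_tree F).
Proof.
rewrite -max_ncrossN -min_treeN -connectN => mt.
by have [] := connect_min_tree FE (exchangeN FX) mt.
Qed.

Lemma max_ncross_max_tree : max_ncross s F (max_tree F).
Proof.
rewrite -max_ncrossN -min_treeN; apply: max_ncross_min_tree => //.
exact: exchangeN.
Qed.

Lemma connect_keeps_above T T' (c : W) : connect (flip_in s F) T T' -> c.1 < c.2 ->
  {in T, forall f, ~~ ecross_up s f c} -> {in T', forall f, ~~ ecross_up s f c}.
Proof.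
move=> /connectP[p pth ->] cc;
  elim: p T pth => //= x p IH T /andP[/and3P[mT mx' fl] pth] H.
by apply: IH pth _; apply: (flip_keeps_above FE FX mT mx' fl cc H).
Qed.
End Duality.

Lemma connect_keeps_below n s (F : {set 'I_n.+2 * 'I_n.+2}) T T'
  (c : 'I_n.+2 * 'I_n.+2) :
  F \subset polygon_edges n -> exchange s F ->
  connect (flip_in s F) T T' -> c.1 < c.2 ->
  {in T', forall f, ~~ ecross_up s c f} -> {in T, forall f, ~~ ecross_up s c f}.
Proof.
move=> FE FX; rewrite -connectN => con cc H f fT; rewrite -ecross_upN.
apply: (connect_keeps_above FE (exchangeN FX) con cc) fT => g gT.
by rewrite ecross_upN; apply: H.
Qed.

(** * Embedding into triangulations *)

Section Embedding.
Variables (n : nat) (s : nat -> bool).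
Notation W := ('I_n.+2 * 'I_n.+2)%type.
Notation PE := (polygon_edges n).
Variables F C : {set W}.
Hypothesis FE : F \subset PE.
Hypothesis FX : exchange s F.
Hypothesis CE : C \subset PE.
Hypothesis Cnc : ncross s C.
Hypothesis CF : {in C & F, forall c f, ~~ ecross s c f}.
Hypothesis Cmax : {in PE, forall e, {in F, forall f, ~~ ecross s e f} ->
  {in C, forall c, ~~ ecross s e c} -> e \in C}.
Hypothesis block : {in PE, forall e, e \notin F ->
  {in C, forall c, ~~ ecross s e c} -> (exists2 f, f \in F & ecross s e f) ->
  (forall t, max_ncross s F t -> exists2 g, g \in t & ecross_up s g e) \/
  (forall t, max_ncross s F t -> exists2 g, g \in t & ecross_up s e g)}.

(** This makes the flip results for [F] available for triangulations as well. *)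
Lemma PEX : exchange s PE.
Proof. by move=> e f _ _; rewrite !inE /= => /orP[] /and4P[]. Qed.

Lemma PE_lt e : e \in PE -> e.1 < e.2. Proof. by rewrite inE. Qed.

Lemma ncross_setU t : max_ncross s F t -> ncross s (t :|: C).
Proof.
case/max_ncrossP => tF nct _; apply/ncrossP => e f;
  rewrite !inE => /orP[et|eC] /orP[ft|fC].
- exact: (ncrossP _ _ nct).
- by rewrite ecrossC; apply: CF => //; apply: (subsetP tF).
- by apply: CF => //; apply: (subsetP tF).
- exact: (ncrossP _ _ Cnc).
Qed.

(** A diagonal crossing nothing in [t] and [C] is in [t] if it lies in [F]. Otherwise [block]
    prevents it from crossing [F], since it would cross [t], and then [Cmax] puts it in [C]. *)
Lemma max_ncross_setU t : max_ncross s F t -> max_ncross s PE (t :|: C).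
Proof.
move=> mt; have /max_ncrossP[tF nct M] := mt; apply/max_ncrossP; split.
- by rewrite subUset CE (subset_trans tF FE).
- exact: ncross_setU.
move=> e eE eT; rewrite inE.
have et f : f \in t -> ~~ ecross s e f by move=> ft; apply: eT; rewrite inE ft.
have eC f : f \in C -> ~~ ecross s e f by move=> fC; apply: eT; rewrite inE fC orbT.
have [eF|eF] := boolP (e \in F); first by rewrite M.
have [/exists_inP[f fF cf]|/exists_inPn nf] := boolP [exists f in F, ecross s e f].
  case: (block eE eF eC (ex_intro2 _ _ f fF cf)) => /(_ t mt)[g gt u];
    case/negP: (et g gt); [rewrite ecrossC|]; exact: ecross_upW.
by rewrite Cmax ?orbT.
Qed.

Lemma setU_sub t : max_ncross s F t -> (t :|: C) :&: F = t.
Proof.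
move=> /max_ncrossP[tF nct M]; apply/setP => e; rewrite !inE.
apply/andP/idP => [[/orP[//|eC] eF]|et]; last by rewrite et (subsetP tF _ et).
by apply: M => // f ft; apply: CF => //; apply: (subsetP tF).
Qed.

(** Nothing in [C] crosses an edge of [F] or [C], so a maximal [T] inside their union contains all
    of [C]. *)
Lemma max_ncross_trace T : max_ncross s PE T -> T \subset F :|: C ->
  max_ncross s F (T :&: F) /\ (T :&: F) :|: C = T.
Proof.
move=> /max_ncrossP[TE ncT M] TFC.
have CT : C \subset T.
  apply/subsetP => c cC; apply: M => [|f fT]; first exact: (subsetP CE).
  move: (subsetP TFC _ fT); rewrite inE => /orP[fF|fC]; first exact: CF.
  exact: (ncrossP _ _ Cnc).
split.
  apply/max_ncrossP; split; first exact: subsetIr.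
    by apply/ncrossP => e f; rewrite !inE => /andP[eT _] /andP[fT _];
      apply: (ncrossP _ _ ncT).
  move=> g gF gT; rewrite inE gF andbT; apply: M => [|f fT];
    first exact: (subsetP FE).
  move: (subsetP TFC _ fT); rewrite inE => /orP[fF|fC].
    by apply: gT; rewrite inE fT.
  by rewrite ecrossC; apply: CF.
apply/setP => e; rewrite !inE; apply/orP/idP => [[/andP[]//|/(subsetP CT)//]|eT].
by move: (subsetP TFC _ eT); rewrite inE eT => /orP[->|->]; [left|right].
Qed.

Lemma flip_setU t t' : flip_in s F t t' -> flip_in s PE (t :|: C) (t' :|: C).
Proof.
case/and3P => mt mt' /exists_inP[e et /exists_inP[e' et' /and3P[ne /eqP E u]]].
apply/and3P; split; [exact: max_ncross_setU|exact: max_ncross_setU|].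
have /max_ncrossP[tF _ _] := mt; have /max_ncrossP[tF' _ _] := mt'.
have eC : e \notin C.
  apply/negP => eC; case/negP: (CF eC (subsetP tF' _ et')); exact: ecross_upW.
have eC' : e' \notin C.
  apply/negP => eC'; case/negP: (CF eC' (subsetP tF _ et)); rewrite ecrossC;
    exact: ecross_upW.
apply/exists_inP; exists e; first by rewrite inE et.
apply/exists_inP; exists e'; first by rewrite inE et'.
rewrite ne u andbT /= !setDUl E; apply/eqP; congr (_ :|: _).
by rewrite !(setDidPl _) // disjoint_sym disjoints1.
Qed.

Lemma flip_setU_inv t t' : max_ncross s F t -> max_ncross s F t' ->
  flip_in s PE (t :|: C) (t' :|: C) -> flip_in s F t t'.
Proof.
move=> mt mt' /and3P[_ _ /exists_inP[e et /exists_inP[e' et' /and3P[ne /eqP E u]]]].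
have ut : e \in t.
  move: et; rewrite inE => /orP[//|eC].
  have e2 : e \in t' :|: C by rewrite inE eC orbT.
  case/negP: (ncrossP _ _ (ncross_setU mt') e e' e2 et'); exact: ecross_upW.
have ut' : e' \in t'.
  move: et'; rewrite inE => /orP[//|eC].
  have e2 : e' \in t :|: C by rewrite inE eC orbT.
  case/negP: (ncrossP _ _ (ncross_setU mt) e e' et e2); exact: ecross_upW.
rewrite /flip_in mt mt' /=; apply/exists_inP; exists e => //.
apply/exists_inP; exists e' => //; rewrite ne u andbT /=.
by rewrite -(setU_sub mt) -(setU_sub mt') -!setIDAC E.
Qed.

Lemma connect_setU t t' : max_ncross s F t ->
  connect (flip_in s F) t t' -> connect (flip_in s PE) (t :|: C) (t' :|: C).
Proof.
move=> mt /connectP[p pth ->]; elim: p t mt pth => //= x p IH t mt /andP[fl pth].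
apply: connect_trans (connect1 (flip_setU fl)) (IH _ _ pth).
by case/and3P: fl.
Qed.

Let bot := min_tree s F :|: C.
Let top := max_tree s F :|: C.

Lemma bot_connect t : max_ncross s F t -> connect (flip_in s PE) bot (t :|: C).
Proof.
by move=> mt; have [m c] := connect_min_tree FE FX mt; apply: connect_setU.
Qed.

Lemma top_connect t : max_ncross s F t -> connect (flip_in s PE) (t :|: C) top.
Proof. by move=> mt; apply: connect_setU => //; apply: connect_max_tree. Qed.

(** Being above [bot], [T] has no edge that crosses an edge of [bot] with smaller slope; being below
    [top], none that crosses an edge of [top] with larger slope. A diagonal outside [F] and [C]
    would violate one of these: it crosses [C], which lies in both, or [block] applies to the
    greatest or the least tree. *)
Lemma interval_sub T : max_ncross s PE T -> connect (flip_in s PE) bot T ->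
  connect (flip_in s PE) T top -> T \subset F :|: C.
Proof.
move=> /max_ncrossP[TE ncT M] cb ct; apply/subsetP => e eT; rewrite inE.
apply/negPn/negP; rewrite negb_or => /andP[eF eC].
have eE := subsetP TE _ eT.
have mb := ncross_setU (max_ncross_min_tree FE FX);
  have mtp := ncross_setU (max_ncross_max_tree FE FX).
have noup c : c \in bot -> ~~ ecross_up s e c.
  move=> cb'; have cc : c.1 < c.2.
    by move: cb'; rewrite !inE => /orP[/andP[/(F_lt FE)]|/(subsetP CE)/PE_lt].
  apply: (connect_keeps_above (subxx _) PEX cb cc) eT => f fb.
  by apply/negP => /ecross_upW; apply/negP/(ncrossP _ _ mb).
have nodown c : c \in top -> ~~ ecross_up s c e.
  move=> cb'; have cc : c.1 < c.2.
    by move: cb'; rewrite !inE => /orP[/andP[/(F_lt FE)]|/(subsetP CE)/PE_lt].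
  apply: (connect_keeps_below (subxx _) PEX ct cc) eT => f fb.
  by apply/negP => /ecross_upW; apply/negP/(ncrossP _ _ mtp).
have eC' c : c \in C -> ~~ ecross s e c.
  move=> cC; have c1 : c \in bot by rewrite inE cC orbT.
  have c2 : c \in top by rewrite inE cC orbT.
  by rewrite /ecross /cross negb_or; rewrite (noup c c1) (nodown c c2).
have [/exists_inP[f fF cf]|/exists_inPn nf] := boolP [exists f in F, ecross s e f].
  case: (block eE eF eC' (ex_intro2 _ _ f fF cf)).
    move=> /(_ _ (max_ncross_max_tree FE FX))[g gt]; apply/negP/nodown.
    by rewrite inE gt.
  move=> /(_ _ (max_ncross_min_tree FE FX))[g gt]; apply/negP/noup.
  by rewrite inE gt.
by case/negP: eC; apply: Cmax.
Qed.

(** Every triangulation on the path lies between [bot] and [top], hence is of the form [x :|: C]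
    with [x] maximal in [F], and each flip on the path restricts to [F]. *)
Lemma connect_setU_inv t t' : max_ncross s F t -> max_ncross s F t' ->
  connect (flip_in s PE) (t :|: C) (t' :|: C) -> connect (flip_in s F) t t'.
Proof.
move=> mt mt' /connectP[p]; elim: p t mt => [|x p IH] t mt /=.
  by move=> _ E; rewrite -(setU_sub mt) -(setU_sub mt') E.
case/andP=> fl pth E.
have mxx : max_ncross s PE x by case/and3P: fl.
have cx : connect (flip_in s PE) x (t' :|: C) by apply/connectP; exists p.
have cb : connect (flip_in s PE) bot x.
  exact: connect_trans (bot_connect mt) (connect1 fl).
have ct := connect_trans cx (top_connect mt').
have [mx' xE] := max_ncross_trace mxx (interval_sub mxx cb ct).
rewrite -xE in fl pth E.
by apply: connect_trans (connect1 (flip_setU_inv mt mx' fl)) (IH _ mx' pth E).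
Qed.
End Embedding.

(** * Merging labels *)

Section Merging.
Variables (s : nat -> bool) (Ib Jb : pred nat).

(* [m] and [j] are consecutive on their side, [m] only white and [j] only black:
   without merging, the quadrilaterals that a tree leaves around [m] and [j] would
   have both diagonals outside the family of tree edges. *)
Definition merges m j := [&& [&& Jb m, ~~ Ib m, Ib j & ~~ Jb j], m < j, s m == s j &
  all (fun x => (Ib x || Jb x) && (m < x) ==> (s x != s j)) (iota 0 j)].

Lemma mergesP m j : reflect
  [/\ [/\ Jb m, ~~ Ib m, Ib j & ~~ Jb j], m < j, s m = s j &
    forall x, Ib x || Jb x -> m < x -> x < j -> s x = ~~ s j] (merges m j).
Proof.
apply: (iffP and4P) => -[/and4P h mj e H]; split=> //; try exact/eqP.
  move=> x Ux ltmx xj; move/allP: H => /(_ x);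
    rewrite mem_iota xj Ux ltmx => /(_ isT) /=.
  by case: (s x) (s j) => [] [].
apply/allP => x; rewrite mem_iota /= => xj; apply/implyP => /andP[Ux ltmx].
by rewrite (H x Ux ltmx xj); case: (s j).
Qed.

(** At most one label merges with [j], as [merged_phi] shows, so the head of the list is that label;
    the default [j] covers the case of none. *)
Definition phi j := head j [seq m <- iota 0 j | merges m j].

Variant phi_spec j : nat -> Prop :=
 | PhiId : (forall m, ~~ merges m j) -> phi_spec j j
 | PhiMerge m : merges m j -> phi_spec j m.

Lemma phiP j : phi_spec j (phi j).
Proof.
rewrite /phi; case E: [seq m <- iota 0 j | merges m j] => [|m l] /=; constructor.
  move=> m; apply/negP => H; have /mergesP[_ mj _ _] := H.
  by have: m \in [::] by rewrite -E mem_filter H mem_iota mj.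
have: m \in m :: l by rewrite inE eqxx.
by rewrite -E mem_filter => /andP[].
Qed.

Lemma phi_le j : phi j <= j.
Proof. by case: phiP => // m /mergesP[_ /ltnW]. Qed.

Lemma phi_U j : Ib j -> Ib (phi j) || Jb (phi j).
Proof. by case: phiP => [_ ->//|m /mergesP[[-> _ _ _] _ _ _] _]; rewrite orbT. Qed.

Lemma phi_J j : Jb j -> phi j = j.
Proof. by case: phiP => // m /mergesP[[_ _ _ /negPf ->]]. Qed.

Lemma phi_mu mu : (forall j, Jb j -> mu < j) -> phi mu = mu.
Proof.
by move=> J_gt; case: phiP => // m /mergesP[[/J_gt + _ _ _] mmu _ _];
  rewrite ltnNge (ltnW mmu).
Qed.

Lemma merges_out m j x : merges m j -> Ib x || Jb x -> s x = s j ->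
  (x <= m) || (j <= x).
Proof.
move=> /mergesP[_ _ _ H] Ux sx; rewrite leqNgt [j <= x]leqNgt -negb_and.
by apply/negP => /andP[ltmx xj]; move: (H x Ux ltmx xj); rewrite sx; case: (s j).
Qed.

Lemma merges_lt m j : merges m j -> m < j. Proof. by case/mergesP. Qed.

Lemma merges_sign m j : merges m j -> s m = s j. Proof. by case/mergesP. Qed.

Lemma merges_notI m j i : merges m j -> Ib i -> i != m.
Proof. by case/mergesP => -[_ nm _ _ _ _ _] Ii; apply: contraNneq nm => <-. Qed.

Lemma merges_notJ m j i : merges m j -> Jb i -> i != j.
Proof. by case/mergesP => -[_ _ _ nj _ _ _] Ii; apply: contraNneq nj => <-. Qed.

Lemma merges_U m j : merges m j -> Ib m || Jb m.
Proof. by case/mergesP => -[-> _ _ _ _ _ _]; rewrite orbT. Qed.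

(** [above_l] compares labels only within one side, and moving a label to the one it merges with
    keeps its side and passes no label in use on that side. *)
Lemma above_l_phi i i' : Ib i -> Ib i' ->
  above_l s (phi i) (phi i') = above_l s i i'.
Proof.
move=> Ii Ii'; have Ui : Ib i || Jb i by rewrite Ii.
have Ui' : Ib i' || Jb i' by rewrite Ii'.
rewrite /above_l; case: (phiP i) => [nm|m mi]; case: (phiP i') => [nm'|m' mi'] //;
  rewrite ?(merges_sign mi) ?(merges_sign mi').
- have := merges_out mi' Ui; have := merges_notI mi' Ii; have := merges_lt mi'.
  have : i != i' by apply: contraTneq mi' => <-; exact: nm.
  by case: (s i) (s i') => [] [] //= A B C /(_ erefl); move: A B C; clear; lia.
- have := merges_out mi Ui'; have := merges_notI mi Ii'; have := merges_lt mi.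
  have : i != i' by apply: contraTneq mi => ->; exact: nm'.
  by case: (s i) (s i') => [] [] //= A B C /(_ erefl); move: A B C; clear; lia.
- have := merges_out mi Ui'; have := merges_out mi' Ui; have := merges_lt mi;
    have := merges_lt mi'.
  have := merges_out mi' (merges_U mi); have := merges_out mi (merges_U mi').
  rewrite (merges_sign mi) (merges_sign mi').
  by case: (s i) (s i') => [] [] //=;
    move=> /(_ erefl) A /(_ erefl) B C D /(_ erefl) E /(_ erefl);
    move: A B C D E; clear; lia.
Qed.

Lemma phi_inj i i' : Ib i -> Ib i' -> phi i = phi i' -> i = i'.
Proof.
move=> Ii Ii' E; have := above_l_phi Ii Ii'; have := above_l_phi Ii' Ii.
by rewrite E above_lxx => L1 L2; case/or3P: (above_l_total s i i') => [/eqP//||];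
  rewrite -?L1 -?L2.
Qed.

(* The overlap test can only change when some end of the other edge lies
   strictly between [phi i] and [i]; its sign is then opposite to that of [i]. *)
Lemma cross_up_phi i j i' j' : Ib i -> Jb j -> i < j -> Ib i' -> Jb j' -> i' < j' ->
  cross_up s (phi i) j (phi i') j' = cross_up s i j i' j'.
Proof.
move=> Ii Jj ij Ii' Jj' ij'; rewrite /cross_up above_l_phi //.
case L: (above_l s i i'); last by rewrite !andbF.
case R: (below_r s j j'); last by rewrite !andbF.
rewrite !andbT; congr andb.
- case: (phiP i') => // m mi; apply/idP/idP => [mj|]; last by have := merges_lt mi;
    lia.
  have := merges_out mi _ _; have := merges_notJ mi Jj; rewrite ltnNge => D O;
    apply/negP => le.
  have {}O := O j (introT orP (or_intror Jj)).
  move: L R; rewrite /above_l /below_r;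
    case: (s i) (s j) (s i') (s j') O => [] [] [] [] //= O; try (have := O erefl);
      move: D mj le ij ij'; clear; lia.
- case: (phiP i) => // m mi; apply/idP/idP => [mj|]; last by have := merges_lt mi;
    lia.
  have := merges_out mi _ _; have := merges_notJ mi Jj'; rewrite ltnNge => D O;
    apply/negP => le.
  have {}O := O j' (introT orP (or_intror Jj')).
  move: L R; rewrite /above_l /below_r;
    case: (s i) (s j) (s i') (s j') O => [] [] [] [] //= O; try (have := O erefl);
      move: D mj le ij ij'; clear; lia.
Qed.

Lemma cross_phi i j i' j' : Ib i -> Jb j -> i < j -> Ib i' -> Jb j' -> i' < j' ->
  cross s (phi i) j (phi i') j' = cross s i j i' j'.
Proof. by move=> *; rewrite /cross !cross_up_phi. Qed.
End Merging.

Lemma merged_phi s Ib Jb m j :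
  merges s Ib Jb m j -> phi s Ib Jb j = m.
Proof.
move=> mj; case: phiP => [/(_ m)|m' mj']; first by rewrite mj.
apply/eqP; rewrite eqn_leq.
have := merges_out mj (merges_U mj') (merges_sign mj').
have := merges_out mj' (merges_U mj) (merges_sign mj).
by rewrite ![j <= _]leqNgt (merges_lt mj) (merges_lt mj') !orbF => -> ->.
Qed.

(** * Neighbouring labels and the edges forced to cross a diagonal *)

Section Blocking.
Variables (s : nat -> bool) (Ib Jb : pred nat) (mu M : nat).
Hypothesis I_mu : Ib mu.
Hypothesis J_M : Jb M.
Hypothesis I_ge : forall i, Ib i -> mu <= i.
Hypothesis J_gt : forall j, Jb j -> mu < j.
Hypothesis J_le : forall j, Jb j -> j <= M.
Hypothesis I_lt : forall i, Ib i -> i < M.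
Notation merges := (merges s Ib Jb).
Notation phi := (phi s Ib Jb).
Notation U x := (Ib x || Jb x).

Lemma U_ge x : U x -> mu <= x.
Proof. by case/orP => [/I_ge|/J_gt/ltnW]. Qed.

Lemma U_le x : U x -> x <= M.
Proof. by case/orP => [/I_lt/ltnW|/J_le]. Qed.

Lemma merged_J m j : merges m j -> Jb m. Proof. by case/mergesP => -[]. Qed.

(** The label in use that precedes [v] on its side is black, since a purely white one would merge
    with [v]. If there is none, [mu] takes its place. *)
Lemma left_neighbour v : Ib v -> ~~ Jb v -> mu < v -> (forall m, ~~ merges m v) ->
  exists a, [/\ Ib a, a < v, s a = s v \/ a = mu &
    forall x, U x -> x < v -> s x = s v -> x <= a].
Proof.
move=> Iv nJv muv nm.
pose P x := [&& U x, x < v & (s x == s v) || (x == mu)].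
have exP : exists x, P x by exists mu; rewrite /P I_mu muv eqxx orbT.
have bP x : P x -> x <= v by case/and3P => _ /ltnW.
case: (ex_maxnP exP bP) => a /and3P[Ua av sa] amax.
have top x : U x -> x < v -> s x = s v -> x <= a.
  by move=> Ux xv sx; apply: amax; rewrite /P Ux xv sx eqxx.
exists a; split=> //; last by case/orP: sa => /eqP; [left|right].
apply/negPn/negP => nIa; have Ja : Jb a by move: Ua; rewrite (negPf nIa).
have {}sa : s a = s v by case/orP: sa => /eqP // E; rewrite E I_mu in nIa.
case/negP: (nm a); apply/mergesP; split=> // x Ux ax xv.
have := top x Ux xv; rewrite leqNgt ax.
by case: (s x) (s v) => [] [] // /(_ erefl).
Qed.

(** Mirror image of [left_neighbour]: the next label on the side of [u] is white, and [M] replaces a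
    missing one. *)
Lemma right_neighbour u : Jb u -> ~~ Ib u -> u < M -> (forall j, ~~ merges u j) ->
  exists b, [/\ Jb b, u < b, s b = s u \/ b = M &
    forall x, U x -> u < x -> s x = s u -> b <= x].
Proof.
move=> Ju nIu uM nm.
pose P x := [&& U x, u < x & (s x == s u) || (x == M)].
have exP : exists x, P x by exists M; rewrite /P J_M orbT uM eqxx orbT.
case: (ex_minnP exP) => b /and3P[Ub ub sb] mn.
have top x : U x -> u < x -> s x = s u -> b <= x.
  by move=> Ux ux sx; apply: mn; rewrite /P Ux ux sx eqxx.
exists b; split=> //; last by case/orP: sb => /eqP; [left|right].
apply/negPn/negP => nJb; have Ib' : Ib b by move: Ub; rewrite (negPf nJb) orbF.
have {}sb : s b = s u by case/orP: sb => /eqP // E; rewrite E J_M in nJb.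
case/negP: (nm b); apply/mergesP; split=> // x Ux ux xb.
have := top x Ux ux; rewrite leqNgt xb sb.
by case: (s x) (s u) => [] [] // /(_ erefl).
Qed.

Lemma phi_sign j : s (phi j) = s j.
Proof. by case: phiP => // m /merges_sign. Qed.

Section Left.
Variables a v : nat.
Hypotheses (Ia : Ib a) (av : a < v) (sa : s a \/ a = mu).
Hypothesis near : forall x, U x -> x < v -> s x -> x <= a.
Hypotheses (Iv : Ib v) (nJv : ~~ Jb v) (nm : forall m, ~~ merges m v).
Hypothesis sv : s v.

Lemma left_top x : U x -> x < v -> x != a -> above_l s a x.
Proof.
move=> Ux xv xa; have := near Ux xv; rewrite /above_l.
case: sa => [->|E]; first by case: (s x) => //= /(_ isT); move: xa; clear; lia.
have := U_ge Ux; rewrite -E; case: (s a); case: (s x) => //= A H;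
  last by move: xa A; clear; lia.
  by move: (H isT) A xa; clear; lia.
by move: (H isT) A xa; clear; lia.
Qed.

(** Since [v] is on the upper side, any edge passing over to [y > v] ends below [v], so only
    [above_l (phi a) u] is at stake. The given crossing edge either starts above [u], and [phi a] is
    at least as high, or ends at an upper label [y0] with [u < y0 <= phi a]. *)
Lemma left_cross u i y0 y : u < v -> Ib i -> Jb y0 -> i < y0 ->
  cross s (phi i) y0 u v -> v < y -> cross_up s (phi a) y u v.
Proof.
move=> uv Ii Jy iy c vy; have uy := ltn_trans uv vy.
have av' : phi a < v := leq_ltn_trans (phi_le _ _ _ _) av.
rewrite /cross_up uy av' /=; apply/andP; split; last by rewrite /below_r sv vy orbT.
case/orP: c => /and4P[o1 o2 L R].
- have [->//|ia] := eqVneq a i; apply: above_l_trans L.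
  have [iv|vi] := ltnP i v.
    by rewrite above_l_phi // left_top ?Ii // eq_sym.
  move: o2; case: phiP => [_|m mi mv]; first by rewrite ltnNge vi.
  have vi' : v < i.
    rewrite ltn_neqAle vi andbT; apply: contraTneq mi => <-; exact: nm.
  have [_ _ sm H] := mergesP _ _ _ _ _ mi.
  have nsm : ~~ s m by move: (H v); rewrite Iv sv sm => /(_ isT mv vi');
    case: (s i).
  rewrite /above_l phi_sign nsm /=; case: sa => [->//|E].
  by rewrite E (phi_mu _ _ J_gt) (J_gt (merged_J mi)) if_same.
- have [sy yv] : s y0 /\ y0 < v by move: R; rewrite /below_r sv; case: (s y0).
  have Uy : U y0 by rewrite Jy orbT.
  have ya := near Uy yv sy.
  case: sa => [sa'|E]; last by have := J_gt Jy; rewrite -E ltnNge ya.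
  suff yp : y0 <= phi a by rewrite /above_l phi_sign sa' (leq_trans o2 yp) orbT.
  case: phiP => // m mi;
    case/orP: (merges_out mi Uy (etrans sy (esym sa'))) => // ay.
  by have := merges_notJ mi Jy; rewrite eqn_leq ya ay.
Qed.

(** If [r < v], then [(p, r)] starts below [a] and can only cross [(a, y)] by ending at an upper
    label strictly between [a] and [v], where there is none. *)
Lemma left_desc p r y : Ib p -> Jb r -> p < r -> v < y -> cross s p r a y -> v < r.
Proof.
move=> Ip Jr pr vy c; rewrite ltnNge; apply/negP => rv.
have {}rv : r < v by rewrite ltn_neqAle rv andbT; apply: contraNneq nJv => <-.
have Ur : U r by rewrite Jr orbT.
have Up : U p by rewrite Ip.
have pa : p != a by apply: contraTneq c => ->; rewrite cross_left.
have L := left_top Up (ltn_trans pr rv) pa.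
case/orP: c => /and4P[o1 o2 L' R']; first by rewrite (above_l_asym L) in L'.
have sr : s r.
  move: R'; rewrite /below_r; case: (s r) => //= /andP[_]; move: rv vy; clear; lia.
by have := near Ur rv sr; rewrite leqNgt o2.
Qed.
End Left.

Section Right.
Variables u b : nat.
Hypotheses (ub : u < b) (sb : s b \/ b = M).
Hypothesis near : forall x, U x -> u < x -> s x -> b <= x.
Hypothesis nIu : ~~ Ib u.
Hypothesis su : s u.

Lemma right_top x : U x -> u < x -> x != b -> below_r s x b.
Proof.
move=> Ux ux xb; have := near Ux ux; rewrite /below_r.
case: sb => [->|E]; first by case: (s x) => //= /(_ isT); move: xb; clear; lia.
have := U_le Ux; rewrite -E; case: (s b); case: (s x) => //= A H;
  last by move: xb A; clear; lia.
  by move: (H isT) A xb; clear; lia.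
by move: (H isT) A xb; clear; lia.
Qed.

(** Mirror image of [left_cross]: an edge starting left of the upper label [u] starts below it, and
    [b] is the highest end available on the right. *)
Lemma right_cross v i y p : u < v -> Ib i -> Jb y -> i < y ->
  cross s (phi i) y u v -> Ib p -> p < u -> cross_up s u v (phi p) b.
Proof.
move=> uv Ii Jy iy c Ip pu.
have pu' : phi p < u := leq_ltn_trans (phi_le _ _ _ _) pu.
rewrite /cross_up (ltn_trans pu' uv) ub {1}/above_l su pu' orbT /=.
have Ui : U (phi i) := phi_U s Jb Ii.
case/orP: c => /and4P[o1 o2 L R].
- have [sx ux] : s (phi i) /\ u < phi i.
    by move: L; rewrite /above_l su; case: (s (phi i)).
  have bx := near Ui ux sx.
  have sb' : s b.
    case: sb => // E; move: bx; rewrite E => /leq_trans /(_ (phi_le _ _ _ _)).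
    by rewrite leqNgt (I_lt Ii).
  by rewrite /below_r sb' (leq_ltn_trans bx o2) orbT.
- have [<-//|yb] := eqVneq y b.
  by apply: below_r_trans R (right_top _ o2 yb); rewrite Jy orbT.
Qed.

Lemma right_desc p r q : Ib p -> Jb r -> p < r -> Ib q -> q < u ->
  cross s p r q b -> p < u.
Proof.
move=> Ip Jr pr Iq qu c; rewrite ltnNge; apply/negP => leup.
have {}leup : u < p by rewrite ltn_neqAle leup andbT; apply: contraNneq nIu => ->.
have rb : r != b by apply: contraTneq c => ->; rewrite cross_right.
have R : below_r s r b by apply: right_top; rewrite ?Jr ?orbT // (ltn_trans leup).
case/orP: c => /and4P[o1 o2 L' R']; last first.
  by have := below_r_trans R R'; rewrite below_rxx.
have sp : s p.
  by move: L'; rewrite /above_l; case: (s p) => //= /andP[_]; move: leup qu; clear;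
    lia.
have Up : U p by rewrite Ip.
by have := near Up leup sp; rewrite leqNgt o2.
Qed.
End Right.

Section Middle.
Variables j0 u v : nat.
Hypotheses (mu0 : merges u j0) (Jv : Jb v) (uv : u < v) (vj : v < j0).

(** The labels in use between [u] and [j0] all lie on the side opposite to [u], in particular [v]
    and any [phi p] between [u] and [v]. Hence the side of [u] alone decides which edge is
    steeper. *)
Lemma middle_cross p r : Ib p -> Jb r -> phi p < v -> phi p != u -> v < r ->
  if s u then cross_up s u v (phi p) r else cross_up s (phi p) r u v.
Proof.
move=> Ip Jr pv pu vr; have Up := phi_U s Jb Ip.
have ur := ltn_trans uv vr; have [_ _ su H] := mergesP _ _ _ _ _ mu0.
have := H v _ uv vj; have := H _ Up _ (ltn_trans pv vj).
rewrite Jv orbT -su /cross_up /above_l /below_r pv ur vr => A /(_ isT) ->.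
have [pltu|ultp] := ltnP (phi p) u.
  by case: (s u); rewrite /= ?pltu ?orbT ?andbT //=; case: (s r); case: (s (phi p)).
have {}ultp : u < phi p by rewrite ltn_neqAle eq_sym pu.
by rewrite (A ultp); case: (s u); case: (s r); rewrite //= ?ultp ?orbT.
Qed.

(** Only [j0] is sent to [u] by [phi], and [p < v < j0]. *)
Lemma middle_desc p r : Ib p -> p < r -> r <= v -> (phi p < v) && (phi p != u).
Proof.
move=> Ip pr rv; have pv := leq_trans pr rv.
rewrite (leq_ltn_trans (phi_le _ _ _ _) pv) /=.
apply/eqP => E; have [[_ _ Ij _] _ _ _] := mergesP _ _ _ _ _ mu0.
have E' : phi j0 = u := merged_phi mu0.
rewrite -E' in E.
by move: (phi_inj Ip Ij E) pv vj; clear; lia.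
Qed.
End Middle.
End Blocking.

(** * Crossings in terms of the cyclic order *)

Section Circular.
Variables (s : nat -> bool) (N : nat).

(* Positions along the boundary: the lower side from left to right, then the upper
   side from right to left. *)
Definition boundary_pos x := if s x then N.*2 - x else x.
Definition interlaced p q x y := [&& p != x, p != y, q != x, q != y &
  ((p < x) (+) (q < x)) (+) ((p < y) (+) (q < y))].

(** The cyclic shift of the positions [0, ..., 2N] that brings [w] to [0]. *)
Definition rotate w x := if w <= x then x - w else x + N.*2.+1 - w.

Lemma cross_interlaced a b c d : a < b <= N -> c < d <= N ->
  cross s a b c d =
    interlaced (boundary_pos a) (boundary_pos b) (boundary_pos c) (boundary_pos d).
Proof.
(* Once the signs are replaced by booleans, these facts still record that labels on different sides
   are distinct. *)
have E x y : (x != y) || (s x == s y) by case: eqVneq => //= ->; rewrite eqxx.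
move: (E a c) (E a d) (E b c) (E b d);
  rewrite /cross /cross_up /above_l /below_r /boundary_pos /interlaced {E}.
case: (s a) (s b) (s c) (s d) => [] [] [] [] /=; rewrite ?orbT ?orbF; lia.
Qed.

Lemma rotate_lt w p x : w <= N.*2 -> p <= N.*2 -> x <= N.*2 -> p != x ->
  (rotate w p < rotate w x) = (p < x) (+) ((w <= p) (+) (w <= x)).
Proof.
by rewrite /rotate => wN pN xN; case: (leqP w p); case: (leqP w x) => /=;
  move: wN pN xN; clear; lia.
Qed.

Lemma rotate_eq w p x : w <= N.*2 -> p <= N.*2 -> x <= N.*2 ->
  (rotate w p == rotate w x) = (p == x).
Proof.
by rewrite /rotate => wN pN xN; case: (leqP w p); case: (leqP w x) => /=;
  move: wN pN xN; clear; lia.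
Qed.

Lemma interlaced_rotate w a b c d : w <= N.*2 -> a <= N.*2 -> b <= N.*2 ->
  c <= N.*2 -> d <= N.*2 ->
  interlaced (rotate w a) (rotate w b) (rotate w c) (rotate w d) =
    interlaced a b c d.
Proof.
move=> wN aN bN cN dN; rewrite /interlaced !rotate_eq //.
case: eqVneq => //= ac; case: eqVneq => //= ad; case: eqVneq => //= bc;
  case: eqVneq => //= bd.
rewrite !rotate_lt //.
by case: (a < c) (b < c) (a < d) (b < d) (w <= a) (w <= b) (w <= c)
  (w <= d) => [] [] [] [] [] [] [] [].
Qed.

Lemma boundary_pos_le x : x <= N -> boundary_pos x <= N.*2.
Proof. by rewrite /boundary_pos; case: (s x); lia. Qed.

Lemma boundary_pos_inj x y : x <= N -> y <= N -> boundary_pos x = boundary_pos y ->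
  x = y.
Proof.
have := eqVneq x y; case=> // xy; move: (xy); rewrite /boundary_pos.
by case: (s x); case: (s y); move: xy; clear; lia.
Qed.

Lemma cross_rotate w a b c d : w <= N -> a < b <= N -> c < d <= N ->
  let K x := rotate (boundary_pos w) (boundary_pos x) in cross s a b c d =
    interlaced (K a) (K b) (K c) (K d).
Proof.
move=> wN abN cdN K;
  rewrite (cross_interlaced abN cdN) /K interlaced_rotate ?boundary_pos_le //;
  by move: abN cdN; clear; lia.
Qed.

Lemma interlacedCl p q x y : interlaced p q x y = interlaced q p x y.
Proof.
rewrite /interlaced.
by case: (p == x) (p == y) (q == x) (q == y) => [] [] [] [] //=;
  congr (_ (+) _); rewrite addbC.
Qed.

Lemma interlacedCr p q x y : interlaced p q x y = interlaced p q y x.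
Proof.
rewrite /interlaced addbC.
by case: (p == x) (p == y) (q == x) (q == y) => [] [] [] [].
Qed.
End Circular.

(** * Sides of the convex hull of a set of vertices *)

Section Hull.
Variables (n : nat) (s : nat -> bool) (Vp : pred nat).
Notation W := ('I_n.+2 * 'I_n.+2)%type.
Notation PE := (polygon_edges n).

Definition hull_sides : {set W} := [set e : W | [&& e.1 < e.2, Vp e.1, Vp e.2 &
  [forall f : W, [&& f.1 < f.2, Vp f.1 & Vp f.2] ==> ~~ ecross s e f]]].

(** An end [w] of [e] outside [Vp] is cut off from all vertices in [Vp] by the hull side joining the
    nearest such vertices on either side of [w]. As [e] separates the ends of [f], its other end
    lies beyond that side. *)
Lemma hull_sides_cross (e f : W) : e.1 < e.2 -> ~~ (Vp e.1 && Vp e.2) ->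
  f.1 < f.2 -> Vp f.1 -> Vp f.2 -> ecross s e f ->
  exists2 c, c \in hull_sides & ecross s e c.
Proof.
move=> e12 eV f12 f1V f2V cef.
have ordN (x : 'I_n.+2) : x <= n.+1 by rewrite -ltnS.
have [w [w' [wV we]]] :
    exists w w' : 'I_n.+2, ~~ Vp w /\ ((w, w') = e \/ (w', w) = e).
  move: eV; rewrite negb_and => /orP[] H.
    by exists e.1, e.2; split=> //; left; case: (e).
  by exists e.2, e.1; split=> //; right; case: (e).
pose K (x : 'I_n.+2) := rotate n.+1 (boundary_pos s n.+1 w) (boundary_pos s n.+1 x).
have K0 : K w = 0 by rewrite /K /rotate leqnn subnn.
have crK (g h : W) : g.1 < g.2 -> h.1 < h.2 ->
    ecross s g h = interlaced (K g.1) (K g.2) (K h.1) (K h.2).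
  by move=> g12 h12; apply: cross_rotate; rewrite ?g12 ?h12 ?ordN.
have cre (g : W) : g.1 < g.2 ->
  ecross s e g = interlaced (K w) (K w') (K g.1) (K g.2).
  by move=> g12; rewrite crK //; case: we => <- //=; rewrite interlacedCl.
have [p [r [pV rV pw rw]]] :
    exists p r : 'I_n.+2, [/\ Vp p, Vp r, K p < K w' & K w' < K r].
  move: cef; rewrite cre // K0 /interlaced => /and5P[z1 z2 y1 y2].
  rewrite !lt0n ![K _ == 0]eq_sym z1 z2 /=.
  have [l1|g1] := ltnP (K w') (K f.1); have [l2|g2] := ltnP (K w') (K f.2) => // _.
    by exists f.2, f.1; split=> //; rewrite ltn_neqAle g2 eq_sym y2.
  by exists f.1, f.2; split=> //; rewrite ltn_neqAle g1 eq_sym y1.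
(* With [w] rotated to position [0], the neighbours of [w] in [Vp] are those of least and greatest
   position. *)
case: (@arg_minnP _ p (fun x => Vp x) K pV) => b bV bmin.
case: (@arg_maxnP _ p (fun x => Vp x) K pV) => a aV amax.
have bw : K b < K w' by apply: leq_ltn_trans (bmin _ pV) pw.
have wa : K w' < K a by apply: leq_trans rw (amax _ rV).
have ab : a != b by apply: contraTneq (ltn_trans bw wa) => ->; rewrite ltnn.
have outer (c f' : W) : (c = (a, b) \/ c = (b, a)) -> c.1 < c.2 ->
    f'.1 < f'.2 -> Vp f'.1 -> Vp f'.2 -> ~~ ecross s c f'.
  move=> cE c12 f12' V1 V2; rewrite crK //.
  have -> : interlaced (K c.1) (K c.2) (K f'.1) (K f'.2) =
    interlaced (K a) (K b) (K f'.1) (K f'.2).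
    by case: cE => -> //=; rewrite interlacedCl.
  have := bmin _ V1; have := bmin _ V2; have := amax _ V1; have := amax _ V2.
  by rewrite /interlaced; clear; lia.
have cross_ab (c : W) : (c = (a, b) \/ c = (b, a)) -> c.1 < c.2 -> ecross s e c.
  move=> cE c12; rewrite cre // K0.
  have -> : interlaced 0 (K w') (K c.1) (K c.2) = interlaced 0 (K w') (K a) (K b).
    by case: cE => -> //=; rewrite interlacedCr.
  have b0 : 0 < K b.
    rewrite lt0n -K0 /K rotate_eq ?boundary_pos_le //.
    by apply/eqP => /(boundary_pos_inj (ordN _) (ordN _)) /val_inj E;
      rewrite -E bV in wV.
  by move: b0 bw wa; rewrite /interlaced; clear; lia.
have [ltab|ltba] : a < b \/ b < a by move: ab; rewrite -val_eqE /= neq_ltn => /orP.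
  exists (a, b); last by apply: cross_ab => //; left.
  rewrite inE ltab aV bV /=; apply/forallP => f'; apply/implyP => /and3P[? ? ?].
  by apply: outer => //; left.
exists (b, a); last by apply: cross_ab => //; right.
rewrite inE ltba aV bV /=; apply/forallP => f'; apply/implyP => /and3P[? ? ?].
by apply: outer => //; right.
Qed.
End Hull.

Lemma phiN s Ib Jb : phi (negb \o s) Ib Jb =1 phi s Ib Jb.
Proof.
move=> j; rewrite /phi; congr head; apply: eq_filter => m; rewrite /merges /=.
rewrite (inj_eq negb_inj); congr [&& _, _, _ & _]; apply: eq_all => x.
by rewrite (inj_eq negb_inj).
Qed.

Lemma mergesN s Ib Jb m j : merges (negb \o s) Ib Jb m j = merges s Ib Jb m j.
Proof.
rewrite /merges /= (inj_eq negb_inj); congr [&& _, _, _ & _]; apply: eq_all => x.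
by rewrite (inj_eq negb_inj).
Qed.

(** * Diagonals crossed by every tree *)

Section MergedEdges.
Variables (n : nat) (s : nat -> bool) (Ib Jb : pred nat) (mu M : nat).
Hypothesis I_mu : Ib mu.
Hypothesis J_M : Jb M.
Hypothesis I_ge : forall i, Ib i -> mu <= i.
Hypothesis J_gt : forall j, Jb j -> mu < j.
Hypothesis J_le : forall j, Jb j -> j <= M.
Hypothesis I_lt : forall i, Ib i -> i < M.
Hypothesis M_le : M <= n.+1.
Notation merges := (merges s Ib Jb).
Notation phi := (phi s Ib Jb).
Notation W := ('I_n.+2 * 'I_n.+2)%type.
Notation PE := (polygon_edges n).

Definition merged_edges : {set W} := [set e : W | Jb e.2 &&
  [exists i : 'I_n.+2, [&& Ib i, phi i == e.1 & i < e.2]]].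

Lemma I_ord i : Ib i -> i < n.+2.
Proof. by move=> /I_lt iM; rewrite ltnS; apply: leq_trans (ltnW iM) M_le. Qed.

Lemma J_ord j : Jb j -> j < n.+2.
Proof. by move=> /J_le jM; rewrite ltnS; apply: leq_trans jM M_le. Qed.

Lemma merged_edgesP (e : W) : reflect
  (exists i : nat, [/\ Ib i, phi i = e.1, Jb e.2 & i < e.2]) (e \in merged_edges).
Proof.
rewrite inE;
  apply: (iffP andP) => [[Je /existsP[i /and3P[Ii /eqP E ie]]]|[i [Ii E Je ie]]].
  by exists i.
split=> //; apply/existsP; exists (Ordinal (I_ord Ii)).
by rewrite Ii ie /= E eqxx.
Qed.

Lemma merged_edges_sub : merged_edges \subset PE.
Proof.
apply/subsetP => e /merged_edgesP[i [Ii E Je ie]]; rewrite inE.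
by rewrite -E (leq_ltn_trans (phi_le _ _ _ _) ie).
Qed.

Lemma merged_edges_exchange : exchange s merged_edges.
Proof.
move=> e f /merged_edgesP[i [Ii E Je ie]] /merged_edgesP[i' [Ii' E' Je' ie']].
rewrite /ecross -E -E' cross_phi // => c; apply/merged_edgesP; exists i;
  split=> //=.
by case/orP: c => /and4P[].
Qed.

Definition used_label x := Jb x || [exists i : 'I_n.+2, Ib i && (phi i == x)].

Lemma used_phi i : Ib i -> used_label (phi i).
Proof.
move=> Ii; apply/orP; right; apply/existsP; exists (Ordinal (I_ord Ii)).
by rewrite Ii eqxx.
Qed.

(** The edges from [phi a], with [a] the left neighbour of [e.2], to labels beyond [e.2] all cross
    [e] with smaller slope. By [left_desc] they satisfy the hypothesis of [crossing_descent], so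
    every tree contains one. *)
Lemma block_left t (e : W) : max_ncross s merged_edges t -> e \in PE -> Ib e.2 ->
  ~~ Jb e.2 ->
  (forall m, ~~ merges m e.2) -> (exists2 f, f \in merged_edges & ecross s e f) ->
  s e.2 -> exists2 g, g \in t & ecross_up s g e.
Proof.
case: e => u v /=; set e := (u, v) => mt;
  rewrite inE /= => uv Iv nJv nm [f fF cef] sv.
have /merged_edgesP[i [Ii E Je ie]] := fF.
have muv : mu < v.
  rewrite ltn_neqAle I_ge // andbT; apply: contraTneq cef => E'.
  have x1 : mu <= f.1 by rewrite -E; apply: (U_ge I_ge J_gt); exact: phi_U.
  by rewrite ecrossC /ecross /cross /cross_up /= -E' [f.1 < _]ltnNge x1 /= andbF.
have [a [Ia av sa near]] := left_neighbour I_mu Iv nJv muv nm.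
have near' x : Ib x || Jb x -> x < v -> s x -> x <= a.
  by move=> Ux xv sx; apply: near => //; rewrite sx sv.
have sa' : s a \/ a = mu by case: sa => [->|->]; [left|right].
pose G := [set g in merged_edges | (g.1 == phi a :> nat) && (v < g.2)].
have [|||g gt gG] := @crossing_descent n s merged_edges merged_edges_sub t G mt.
- apply/set0Pn; exists (inord (phi a), inord M).
  have aM := ltn_trans av (I_lt Iv).
  have pa : (inord (phi a) : 'I_n.+2) = phi a :> nat.
    by rewrite inordK // (leq_ltn_trans (phi_le _ _ _ _)) // I_ord.
  have pM : (inord M : 'I_n.+2) = M :> nat by rewrite inordK // J_ord.
  rewrite inE /= pa pM eqxx I_lt // !andbT; apply/merged_edgesP; exists a.
  by rewrite /= pa pM.
- by apply/subsetP => g; rewrite inE => /andP[].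
- move=> g h; rewrite inE => /andP[gF /andP[/eqP g1 g2]] ht c.
  apply/or3P; apply: Or33;
    have hF : h \in merged_edges by case/max_ncrossP: mt => /subsetP/(_ _ ht).
  rewrite inE (merged_edges_exchange gF hF c) /= g1 eqxx /=; move: c;
    rewrite ecrossC /ecross g1.
  have /merged_edgesP[p [Ip Ep Jr pr]] := hF;
    have /merged_edgesP[q [Iq Eq Jq qr]] := gF.
  rewrite -Ep cross_phi //; last exact: ltn_trans g2.
  exact: (left_desc I_ge J_gt (a := a)).
exists g => //; move: gG; rewrite inE => /andP[gF /andP[/eqP g1 g2]].
have /merged_edgesP[q [Iq Eq Jq qr]] := gF.
rewrite /ecross_up g1;
  apply: (left_cross I_ge J_gt Ia av sa' near' Iv nm sv uv Ii Je ie) => //.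
by rewrite E; rewrite ecrossC in cef.
Qed.

(** The corresponding descent among edges that end at the right neighbour [b] of [e.1] and start,
    before merging, to the left of [e.1]. *)
Lemma block_right t (e : W) : max_ncross s merged_edges t -> e \in PE -> Jb e.1 ->
  ~~ Ib e.1 ->
  (forall j, ~~ merges e.1 j) -> (exists2 f, f \in merged_edges & ecross s e f) ->
  s e.1 -> exists2 g, g \in t & ecross_up s e g.
Proof.
case: e => u v /=; set e := (u, v) => mt;
  rewrite inE /= => uv Ju nIu nm [f fF cef] su.
have /merged_edgesP[i [Ii E Je ie]] := fF.
have uM : u < M.
  rewrite ltn_neqAle J_le // andbT; apply: contraTneq cef => E'.
  by rewrite /ecross /cross /cross_up /= E' ![M < _]ltnNge (J_le Je) /= andbF.
have [b [Jb_b ub sb near]] := right_neighbour J_M Ju nIu uM nm.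
have near' x : Ib x || Jb x -> u < x -> s x -> b <= x.
  by move=> Ux xv sx; apply: near => //; rewrite sx su.
have sb' : s b \/ b = M by case: sb => [->|->]; [left|right].
pose G := [set g in merged_edges | (g.2 == b :> nat) &&
  [exists i : 'I_n.+2, [&& Ib i, i < u & phi i == g.1]]].
have GP (g : W) i0 : g \in merged_edges -> g.2 = b :> nat -> Ib i0 -> i0 < u ->
  phi i0 = g.1 -> g \in G.
  move=> gF g2 I0 lt0 E0; rewrite inE gF g2 eqxx; apply/existsP.
  by exists (Ordinal (I_ord I0)); rewrite I0 lt0 /= E0 eqxx.
have [|||g gt gG] := @crossing_descent n s merged_edges merged_edges_sub t G mt.
- apply/set0Pn; exists (inord (phi mu), inord b).
  have pa : (inord (phi mu) : 'I_n.+2) = phi mu :> nat.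
    by rewrite inordK // (leq_ltn_trans (phi_le _ _ _ _)) // I_ord.
  have pb : (inord b : 'I_n.+2) = b :> nat by rewrite inordK // J_ord.
  apply: (GP _ mu) => //=; last exact: J_gt.
  by apply/merged_edgesP; exists mu; rewrite /= pa pb J_gt.
- by apply/subsetP => g; rewrite inE => /andP[].
- move=> g h;
    rewrite inE => /andP[gF /andP[/eqP g2 /existsP[q /and3P[Iq qu /eqP Eq]]]] ht c.
  apply/or3P; apply: Or32;
    have hF : h \in merged_edges by case/max_ncrossP: mt => /subsetP/(_ _ ht).
  have hgF : (h.1, g.2) \in merged_edges by apply: merged_edges_exchange => //;
    rewrite ecrossC.
  have /merged_edgesP[p [Ip Ep Jr pr]] := hF.
  apply: (GP _ p) => //; move: c; rewrite ecrossC /ecross g2 -Eq -Ep cross_phi //.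
    exact: (right_desc J_le I_lt sb' near' nIu).
  exact: ltn_trans ub.
exists g => //; move: gG;
  rewrite inE => /andP[gF /andP[/eqP g2 /existsP[q /and3P[Iq qu /eqP Eq]]]].
rewrite /ecross_up g2 -Eq;
  apply: (right_cross J_le I_lt ub sb' near' su uv Ii Je ie) => //.
by rewrite E; rewrite ecrossC in cef.
Qed.

(** Here [e] is the image of no tree edge because its left end stands for [j0], to the right of
    [e.2]. The descent runs among the edges passing over or under [e.2] that do not start at
    [e.1]. *)
Lemma block_middle t (e : W) j0 : max_ncross s merged_edges t -> merges e.1 j0 ->
  Jb e.2 ->
  e.1 < e.2 -> e.2 < j0 ->
  exists2 g, g \in t & if s e.1 then ecross_up s e g else ecross_up s g e.
Proof.
case: e => u v /= mt m0 Jv uv vj.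
pose G := [set g in merged_edges | [&& g.1 < v, g.1 != u :> nat & v < g.2]].
have [[Ju nIu Ij nJj] _ _ _] := mergesP _ _ _ _ _ m0.
have [|||g gt gG] := @crossing_descent n s merged_edges merged_edges_sub t G mt.
- apply/set0Pn; exists (inord mu, inord M).
  have pa : (inord mu : 'I_n.+2) = mu :> nat by rewrite inordK // I_ord.
  have pM : (inord M : 'I_n.+2) = M :> nat by rewrite inordK // J_ord.
  rewrite inE /= pa pM J_gt // (ltn_trans vj (I_lt Ij)) andbT.
  rewrite neq_ltn J_gt // andbT; apply/merged_edgesP; exists mu.
  by rewrite /= pa pM (phi_mu _ _ J_gt) I_lt.
- by apply/subsetP => g; rewrite inE => /andP[].
- move=> g h; rewrite inE => /andP[gF /and3P[g1 g1u g2]] ht c.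
  have hF : h \in merged_edges by case/max_ncrossP: mt => /subsetP/(_ _ ht).
  have /merged_edgesP[p [Ip Ep Jr pr]] := hF.
  apply/or3P; have [vh|hv] := ltnP v h.2.
    by apply: Or33; rewrite inE /= g1 g1u vh !andbT; apply: merged_edges_exchange.
  have /andP[h1 h2] := middle_desc m0 vj Ip pr hv.
  by apply: Or32; rewrite inE /= -Ep h1 h2 g2 /= andbT;
    apply: merged_edges_exchange => //; rewrite ecrossC.
exists g => //; move: gG; rewrite inE => /andP[gF /and3P[g1 g1u g2]].
have /merged_edgesP[p [Ip Ep Jr pr]] := gF.
by rewrite /ecross_up -Ep; apply: (middle_cross m0 Jv uv vj Ip Jr) => //;
  rewrite Ep.
Qed.
End MergedEdges.

Lemma merged_edgesN n s Ib Jb : merged_edges n (negb \o s) Ib Jb =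
  merged_edges n s Ib Jb.
Proof.
apply/setP => e; rewrite !inE; congr andb; apply: eq_existsb => i.
by rewrite phiN.
Qed.

(** * The blocking property and the fixed set of diagonals *)

Section Frame.
Variables (n : nat) (s : nat -> bool) (Ib Jb : pred nat) (mu M : nat).
Hypothesis I_mu : Ib mu.
Hypothesis J_M : Jb M.
Hypothesis I_ge : forall i, Ib i -> mu <= i.
Hypothesis J_gt : forall j, Jb j -> mu < j.
Hypothesis J_le : forall j, Jb j -> j <= M.
Hypothesis I_lt : forall i, Ib i -> i < M.
Hypothesis M_le : M <= n.+1.
Notation merges := (merges s Ib Jb).
Notation phi := (phi s Ib Jb).
Notation F := (merged_edges n s Ib Jb).
Notation used := (used_label n s Ib Jb).
Notation W := ('I_n.+2 * 'I_n.+2)%type.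
Notation PE := (polygon_edges n).

Lemma block : {in PE, forall e : W, e \notin F ->
  {in hull_sides n s used, forall c, ~~ ecross s e c} ->
  (exists2 f, f \in F & ecross s e f) ->
  (forall t, max_ncross s F t -> exists2 g, g \in t & ecross_up s g e) \/
  (forall t, max_ncross s F t -> exists2 g, g \in t & ecross_up s e g)}.
Proof.
move=> e eE eF eC crossF; have e12 : e.1 < e.2 by move: eE; rewrite inE.
have crossFN : exists2 f,
  f \in merged_edges n (negb \o s) Ib Jb & ecross (negb \o s) e f.
  by case: crossF => f fF c; exists f; rewrite ?merged_edgesN ?ecrossN.
(* Otherwise [e] would cross a side of the hull. *)
have /andP[u1 u2] : used e.1 && used e.2.
  apply/negPn/negP => nu; case: crossF => f fF c.
  have /(merged_edgesP s Jb I_lt M_le)[i [Ii E Je ie]] := fF.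
  have f12 : f.1 < f.2 by rewrite -E (leq_ltn_trans (phi_le _ _ _ _)).
  have V1 : used f.1 by rewrite -E; apply: (used_phi s Jb I_lt M_le).
  have V2 : used f.2 by rewrite /used_label Je.
  have [c0 c0C c0e] := hull_sides_cross e12 nu f12 V1 V2 c.
  by have := eC _ c0C; rewrite c0e.
(* A right end that is not white is an unmerged black label, and [block_left] applies, after
   reflection if it lies on the lower side. *)
have [Je2|nJe2] := boolP (Jb e.2); last first.
  move: u2; rewrite /used_label (negPf nJe2) /= => /existsP[i /andP[Ii /eqP Ei]].
  have nm m : ~~ merges m i.
    by apply/negP => mi; move: Ei nJe2; case: phiP => [/(_ m)|m' /merged_J J' <-];
      rewrite ?mi ?J'.
  have {}Ei : i = e.2 :> nat by move: Ei; case: phiP => // m';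
    rewrite (negPf (nm _)).
  rewrite Ei in Ii nm; case E: (s e.2); [left|right] => t mt.
    exact: (block_left I_mu J_M I_ge J_gt I_lt M_le mt).
  have [|||g gt u] :=
    @block_left n (negb \o s) Ib Jb mu M I_mu J_M I_ge J_gt I_lt M_le t e
      _ eE Ii nJe2 _ crossFN.
  - by rewrite merged_edgesN max_ncrossN.
  - by move=> m; rewrite mergesN.
  - by rewrite /= E.
  - by exists g => //; rewrite -ecross_upN.
(* If the left end is some [phi i], then [i < e.2] would put [e] in [F]; so [i] was merged and
   [block_middle] applies. Otherwise the left end is purely white and unmerged, the case of
   [block_right]. *)
have [[i [Ii Ei]]|nphi] := pselect (exists i, Ib i /\ phi i = e.1).
  have ei : e.2 <= i.
    rewrite leqNgt; apply: contra eF => ie; apply/(merged_edgesP s Jb I_lt M_le).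
    by exists i.
  have m0 : merges e.1 i.
    move: Ei; case: phiP => [_ E|m mi <- //].
    by move: ei; rewrite E leqNgt e12.
  have e2i : (e.2 : nat) < i.
    by rewrite ltn_neqAle ei andbT; apply: merges_notJ m0 Je2.
  case E: (s e.1); [right|left] => t mt;
    by have := block_middle I_mu J_M J_gt I_lt M_le mt m0 Je2 e12 e2i; rewrite E.
have Je1 : Jb e.1.
  move: u1 => /orP[//|/existsP[i /andP[Ii /eqP Ei]]].
  by case: nphi; exists i.
have nIe1 : ~~ Ib e.1.
  by apply/negP => Ie1; case: nphi; exists e.1; rewrite phi_J.
have nm j : ~~ merges e.1 j.
  apply/negP => mj; case: nphi; have [[_ _ Ij _] _ _ _] := mergesP _ _ _ _ _ mj.
  by exists j; split=> //; apply: merged_phi.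
case E: (s e.1); [right|left] => t mt.
  exact: (block_right I_mu J_M J_gt J_le I_lt M_le mt).
have [|||g gt u] :=
  @block_right n (negb \o s) Ib Jb mu M I_mu J_M J_gt J_le I_lt M_le t e
    _ eE Je1 nIe1 _ crossFN.
- by rewrite merged_edgesN max_ncrossN.
- by move=> m; rewrite mergesN.
- by rewrite /= E.
- by exists g => //; rewrite -ecross_upN.
Qed.

Lemma frame_exists : exists C : {set W}, [/\ C \subset PE, ncross s C,
  {in C & F, forall c f, ~~ ecross s c f},
  {in PE, forall e, {in F, forall f, ~~ ecross s e f} ->
    {in C, forall c, ~~ ecross s e c} -> e \in C} & hull_sides n s used \subset C].
Proof.
pose N := [set e in PE | [forall f in F, ~~ ecross s e f]].
have usedF f : f \in F -> [/\ f.1 < f.2, used f.1 & used f.2].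
  case/(merged_edgesP s Jb I_lt M_le) => i [Ii E Je ie]; rewrite /used_label Je -E;
    split=> //.
    by rewrite (leq_ltn_trans (phi_le _ _ _ _)).
  exact: (used_phi s Jb I_lt M_le).
have hullP c : c \in hull_sides n s used -> [/\ c.1 < c.2, used c.1, used c.2 &
    forall f : W, f.1 < f.2 -> used f.1 -> used f.2 -> ~~ ecross s c f].
  rewrite inE => /and4P[c12 c1 c2 /forallP H]; split=> // f f12 f1 f2.
  by move: (H f); rewrite f12 f1 f2.
have [||C /max_ncrossP[CN ncC M_C] hC] :=
  @max_ncross_exists n s N (hull_sides n s used).
- apply/subsetP => c /hullP[c12 c1 c2 H]; rewrite !inE c12 /=.
  by apply/forall_inP => f /usedF[]; exact: H.
- by apply/ncrossP => c c' /hullP[_ _ _ H] /hullP[c12 c1 c2 _]; apply: H.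
exists C; split=> //.
- by apply: subset_trans CN _; apply/subsetP => e; rewrite inE => /andP[].
- move=> c f cC fF; have := subsetP CN _ cC.
  by rewrite inE => /andP[_ /forall_inP]; apply.
move=> e eE eF eC; apply: M_C => //.
by rewrite inE eE; apply/forall_inP.
Qed.
End Frame.

(** * Convex polygons in the plane *)

Section Lines.
Local Open Scope ring_scope.
Variable R : realType.
Implicit Types a b c d z : R * R.

Definition line_at a b (x : R) : R := a.2 + slope a b * (x - a.1).

Lemma line_at_left a b : line_at a b a.1 = a.2.
Proof. by rewrite /line_at subrr mulr0 addr0. Qed.

Lemma line_at_right a b : a.1 < b.1 -> line_at a b b.1 = b.2.
Proof.
move=> ab; rewrite /line_at /slope divfK; first by rewrite addrC subrK.
by rewrite subr_eq0 gt_eqF.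
Qed.

Lemma line_atB a b x y : line_at a b x - line_at a b y = slope a b * (x - y).
Proof. by rewrite /line_at; ring. Qed.

Lemma segment_interiorE a b z : a.1 < b.1 ->
  segment_interior a b z <-> a.1 < z.1 < b.1 /\ z.2 = line_at a b z.1.
Proof.
move=> ab; have ba0 : b.1 - a.1 != 0 by rewrite subr_eq0 gt_eqF.
split=> [[t [/andP[t0 t1] -> ->]]|[/andP[az zb] z2]].
  split; first by apply/andP; split; nra.
  by rewrite /line_at /slope; field.
exists ((z.1 - a.1) / (b.1 - a.1)); split.
- by rewrite divr_gt0 ?ltr_pdivrMr ?mul1r ?subr_gt0 // ltrD2r.
- by field.
- by rewrite z2 /line_at /slope; field.
Qed.

Lemma lines_cross a b c d x y : a.1 < b.1 -> c.1 < d.1 ->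
  a.1 <= x -> c.1 <= x -> y <= b.1 -> y <= d.1 -> x < y ->
  line_at c d x < line_at a b x -> line_at a b y < line_at c d y ->
  segments_cross a b c d /\ slope a b < slope c d.
Proof.
move=> ab cd ax cx yb yd xy hx hy.
have E1 := line_atB a b y x; have E2 := line_atB c d y x.
have lts : slope a b < slope c d by nra.
(* [t] is the distance from [x] at which the difference of the two lines vanishes. *)
split=> //; pose t := (line_at a b x - line_at c d x) / (slope c d - slope a b).
have t0 : 0 < t by rewrite divr_gt0 // subr_gt0.
have ty : t < y - x by rewrite ltr_pdivrMr ?subr_gt0 //; nra.
have tE : t * (slope c d - slope a b) = line_at a b x - line_at c d x.
  by rewrite divfK // subr_eq0 gt_eqF.
exists (x + t, line_at a b (x + t)); split; apply/segment_interiorE => //=.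
  by split=> //; apply/andP; split; lra.
split; first by apply/andP; split; lra.
have F1 := line_atB a b (x + t) x; have F2 := line_atB c d (x + t) x.
by nra.
Qed.
End Lines.

(** * Crossing segments between vertices of a convex polygon *)

Section ConvexChain.
Local Open Scope ring_scope.
Variables (R : realType) (V : finType) (pt : V -> R * R) (rk : V -> nat).
Variables (first last : V) (sg : nat -> bool).
Hypothesis convex : convex_polygon pt.
Hypothesis mono : forall u v, (rk u < rk v)%N -> (pt u).1 < (pt v).1.
Hypothesis rk_inj : injective rk.
Hypothesis first_min : forall v, (rk first <= rk v)%N.
Hypothesis last_max : forall v, (rk v <= rk last)%N.
Hypothesis sides : forall v, v != first -> v != last ->
  (if sg (rk v) then @above_line R else @below_line R) (pt first) (pt last) (pt v).

(** The weight function sums indicators, so the four vertices may coincide. *)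
Lemma not_combination4 (v a b c d : V) (ka kb kc kd : R) :
  0 <= ka -> 0 <= kb -> 0 <= kc -> 0 <= kd -> ka + kb + kc + kd = 1 ->
  v != a -> v != b -> v != c -> v != d ->
  (pt v).1 = ka * (pt a).1 + kb * (pt b).1 + kc * (pt c).1 + kd * (pt d).1 ->
  (pt v).2 = ka * (pt a).2 + kb * (pt b).2 + kc * (pt c).2 + kd * (pt d).2 -> False.
Proof.
move=> a0 b0 c0 d0 s1 va vb vc vd E1 E2.
pose w u : R :=
  ka * (u == a)%:R + kb * (u == b)%:R + kc * (u == c)%:R + kd * (u == d)%:R.
have sumw (g : V -> R) :
    \sum_u w u * g u = ka * g a + kb * g b + kc * g c + kd * g d.
  have delta k x : \sum_u k * (u == x)%:R * g u = k * g x.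
    rewrite (bigD1 x) //= eqxx mulr1 big1 ?addr0 // => u /negPf ->.
    by rewrite mulr0 mul0r.
  rewrite -!delta -!big_split /=; apply: eq_bigr => u _; rewrite /w; ring.
apply: (convex (v := v) (c := w)).
- by move=> u; rewrite /w !addr_ge0 // mulr_ge0.
- under eq_bigr do rewrite -[w _]mulr1.
  by rewrite (sumw (fun=> 1)) !mulr1.
- by rewrite /w (negPf va) (negPf vb) (negPf vc) (negPf vd) !mulr0 !addr0.
- by rewrite !sumw E1 E2.
Qed.

Lemma ord_x u v : (rk u < rk v)%N = ((pt u).1 < (pt v).1).
Proof.
apply/idP/idP => [/mono//|]; apply: contraTT; rewrite -leqNgt -leNgt leq_eqVlt.
by move=> /orP[/eqP/rk_inj -> //|/mono/ltW].
Qed.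

(* Otherwise [v] would be vertically between the chords [first]--[last] and
   [u]--[w], hence a convex combination of their endpoints. *)
Lemma chain_side u v w : (rk u < rk v)%N -> (rk v < rk w)%N ->
  if sg (rk v) then line_at (pt u) (pt w) (pt v).1 < (pt v).2
  else (pt v).2 < line_at (pt u) (pt w) (pt v).1.
Proof.
move=> uv vw; set f := first; set l := last.
have fv : v != f by apply: contraTneq uv => ->; rewrite -leqNgt first_min.
have lv : v != l by apply: contraTneq vw => ->; rewrite -leqNgt last_max.
have nu : v != u by apply: contraTneq uv => ->; rewrite ltnn.
have nw : v != w by apply: contraTneq vw => ->; rewrite ltnn.
have xuv := mono uv; have xvw := mono vw.
have xfv : (pt f).1 < (pt v).1.
  by apply: mono; rewrite ltn_neqAle first_min andbT;
    apply: contraNneq fv => /rk_inj ->.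
have xvl : (pt v).1 < (pt l).1.
  by apply: mono; rewrite ltn_neqAle last_max andbT;
    apply: contraNneq lv => /rk_inj ->.
have no_between t : 0 <= t <= 1 -> (pt v).2 =
    (1 - t) * line_at (pt f) (pt l) (pt v).1 +
    t * line_at (pt u) (pt w) (pt v).1 -> False.
  move=> /andP[t0 t1] E.
  (* [al] and [be] locate the abscissa of [v] on the two chords; the weights used below combine
     these positions with [t]. *)
  pose al := ((pt v).1 - (pt f).1) / ((pt l).1 - (pt f).1).
  pose be := ((pt v).1 - (pt u).1) / ((pt w).1 - (pt u).1).
  have alE : (pt v).1 = (1 - al) * (pt f).1 + al * (pt l).1.
    by rewrite /al; field; rewrite subr_eq0 gt_eqF // (lt_trans xfv).
  have beE : (pt v).1 = (1 - be) * (pt u).1 + be * (pt w).1.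
    by rewrite /be; field; rewrite subr_eq0 gt_eqF // (lt_trans xuv).
  have al01 : 0 <= al <= 1.
    have p : 0 < (pt l).1 - (pt f).1 by lra.
    by rewrite /al divr_ge0 ?(ltW p) ?ler_pdivrMr // ?mul1r; lra.
  have be01 : 0 <= be <= 1.
    have p : 0 < (pt w).1 - (pt u).1 by lra.
    by rewrite /be divr_ge0 ?(ltW p) ?ler_pdivrMr // ?mul1r; lra.
  have fl2 : line_at (pt f) (pt l) (pt v).1 = (1 - al) * (pt f).2 + al * (pt l).2.
    by rewrite /line_at /slope /al; field;
      rewrite subr_eq0 gt_eqF // (lt_trans xfv).
  have uw2 : line_at (pt u) (pt w) (pt v).1 = (1 - be) * (pt u).2 + be * (pt w).2.
    by rewrite /line_at /slope /be; field;
      rewrite subr_eq0 gt_eqF // (lt_trans xuv).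
  case/andP: al01 => al0 al1; case/andP: be01 => be0 be1.
  apply: (@not_combination4 v f l u w ((1 - t) * (1 - al)) ((1 - t) * al)
    (t * (1 - be)) (t * be)) => //.
  - by rewrite mulr_ge0 // subr_ge0.
  - by rewrite mulr_ge0 // subr_ge0.
  - by rewrite mulr_ge0 // subr_ge0.
  - by rewrite mulr_ge0.
  - by ring.
  - transitivity ((1 - t) * (pt v).1 + t * (pt v).1); first by ring.
    by rewrite {1}alE beE; ring.
  - by rewrite E fl2 uw2; ring.
pose Lf := line_at (pt f) (pt l) (pt v).1.
pose Lu := line_at (pt u) (pt w) (pt v).1.
have tE : Lu != Lf -> (pt v).2 =
    (1 - ((pt v).2 - Lf) / (Lu - Lf)) * Lf + ((pt v).2 - Lf) / (Lu - Lf) * Lu.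
  by move=> ne; field; rewrite subr_eq0.
have := sides fv lv; case: (sg (rk v));
  rewrite /above_line /below_line -/(line_at _ _ _) -/f -/l -/Lf -/Lu => Hf.
- rewrite ltNge; apply/negP => Hu.
  have p : 0 < Lu - Lf by lra.
  apply: (no_between _ _ (tE _)); last by rewrite -subr_eq0 gt_eqF.
  by rewrite divr_ge0 ?(ltW p) ?ler_pdivrMr // ?mul1r; lra.
- rewrite ltNge; apply/negP => Hu.
  have p : 0 < Lf - Lu by lra.
  have q : ((pt v).2 - Lf) / (Lu - Lf) = (Lf - (pt v).2) / (Lf - Lu).
    by rewrite -[RHS]mulrNN -invrN !opprB.
  apply: (no_between _ _ (tE _));
    last by rewrite -subr_eq0 lt_eqF // -subr_gt0 sub0r opprB.
  by rewrite q divr_ge0 ?(ltW p) ?ler_pdivrMr // ?mul1r; lra.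
Qed.

(** At this abscissa one of the edges has its left end, and [chain_side] tells on which side of the
    other edge that vertex lies. *)
Lemma above_l_line a b c d : (rk a < rk b)%N -> (rk c < rk d)%N ->
  (rk c < rk b)%N -> (rk a < rk d)%N -> above_l sg (rk a) (rk c) ->
  line_at (pt c) (pt d) (Num.max (pt a).1 (pt c).1) <
  line_at (pt a) (pt b) (Num.max (pt a).1 (pt c).1).
Proof.
move=> ab cd cb ad L.
have [ac|ca|/rk_inj ac] := ltngtP (rk a) (rk c); last first.
- by move: L; rewrite /above_l ac ltnn; case: (sg (rk c)).
- rewrite max_l ?ltW ?mono // line_at_left.
  have := chain_side ca ad; have := L; rewrite /above_l.
  case: (sg (rk a)) => // /andP[_]; by rewrite ltnNge (ltnW ca).
- rewrite max_r ?ltW ?mono // line_at_left.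
  have := chain_side ac cb; have := L; rewrite /above_l.
  case: (sg (rk c)) => //; case: (sg (rk a)) => //=; by rewrite ltnNge (ltnW ac).
Qed.

Lemma below_r_line a b c d : (rk a < rk b)%N -> (rk c < rk d)%N ->
  (rk c < rk b)%N -> (rk a < rk d)%N -> below_r sg (rk b) (rk d) ->
  line_at (pt a) (pt b) (Num.min (pt b).1 (pt d).1) <
  line_at (pt c) (pt d) (Num.min (pt b).1 (pt d).1).
Proof.
move=> ab cd cb ad L.
have [bd|db|/rk_inj bd] := ltngtP (rk b) (rk d); last first.
- by move: L; rewrite /below_r bd ltnn; case: (sg (rk d)).
- rewrite min_r ?ltW ?mono // (line_at_right (mono cd)).
  have := chain_side ad db; have := L; rewrite /below_r.
  case: (sg (rk d)) => // /andP[_]; by rewrite ltnNge (ltnW db).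
- rewrite min_l ?ltW ?mono // (line_at_right (mono ab)).
  have := chain_side cb bd; have := L; rewrite /below_r.
  case: (sg (rk b)) => //; case: (sg (rk d)) => //=; by rewrite ltnNge (ltnW bd).
Qed.

Lemma max_lt_min a b c d : (rk a < rk b)%N -> (rk c < rk d)%N ->
  (rk c < rk b)%N -> (rk a < rk d)%N ->
  Num.max (pt a).1 (pt c).1 < Num.min (pt b).1 (pt d).1.
Proof. by move=> ab cd cb ad; rewrite gt_max !lt_min !mono. Qed.

Lemma cross_up_segments a b c d : (rk a < rk b)%N -> (rk c < rk d)%N ->
  cross_up sg (rk a) (rk b) (rk c) (rk d) ->
  segments_cross (pt a) (pt b) (pt c) (pt d) /\
  slope (pt a) (pt b) < slope (pt c) (pt d).
Proof.
move=> ab cd /and4P[cb ad L Rr].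
apply: (lines_cross (mono ab) (mono cd) _ _ _ _ (max_lt_min ab cd cb ad)
  (above_l_line ab cd cb ad L) (below_r_line ab cd cb ad Rr)).
- by rewrite le_max lexx.
- by rewrite le_max lexx orbT.
- by rewrite ge_min lexx.
- by rewrite ge_min lexx orbT.
Qed.

(** The difference of the two lines vanishes at the common point, so it changes sign between the
    ends of the overlap. Signs that agree there are excluded, and so is a shared endpoint, which
    would give a second zero. *)
Lemma segments_cross_up a b c d : (rk a < rk b)%N -> (rk c < rk d)%N ->
  (a, b) != (c, d) -> segments_cross (pt a) (pt b) (pt c) (pt d) ->
  cross sg (rk a) (rk b) (rk c) (rk d).
Proof.
move=> ab cd ne [z [/(segment_interiorE _ (mono ab))[/andP[az zb] z2]]].
move=> /(segment_interiorE _ (mono cd))[/andP[cz zd] z2'].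
have cb : (rk c < rk b)%N by rewrite ord_x (lt_trans cz).
have ad : (rk a < rk d)%N by rewrite ord_x (lt_trans az).
have xz : Num.max (pt a).1 (pt c).1 < z.1 by rewrite gt_max az.
have zy : z.1 < Num.min (pt b).1 (pt d).1 by rewrite lt_min zb.
set x := Num.max _ _ in xz; set y := Num.min _ _ in zy.
have E1 := line_atB (pt a) (pt b) x z.1; have E2 := line_atB (pt c) (pt d) x z.1.
have E3 := line_atB (pt a) (pt b) y z.1; have E4 := line_atB (pt c) (pt d) y z.1.
rewrite -z2 in E1 E3; rewrite -z2' in E2 E4.
have L1 := above_l_line ab cd cb ad; have L2 := above_l_line cd ab ad cb.
have R1 := below_r_line ab cd cb ad; have R2 := below_r_line cd ab ad cb.
rewrite /= ?[Num.max (pt c).1 _]maxC ?[Num.min (pt d).1 _]minC -/x -/y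
  in L1 L2 R1 R2.
rewrite /cross /cross_up cb ad /=.
case/or3P: (above_l_total sg (rk a) (rk c)) => H1;
  case/or3P: (below_r_total sg (rk b) (rk d)) => H2.
- by rewrite (rk_inj (eqP H1)) (rk_inj (eqP H2)) eqxx in ne.
- have := R1 H2; move/eqP/rk_inj in H1; subst c.
  by move: E1 E2 xz; rewrite /x maxxx !line_at_left; nra.
- have := R2 H2; move/eqP/rk_inj in H1; subst c.
  by move: E1 E2 xz; rewrite /x maxxx !line_at_left; nra.
- have := L1 H1; move/eqP/rk_inj in H2; subst d.
  by move: E3 E4 zy; rewrite /y minxx !line_at_right ?mono //; nra.
- by rewrite H1 H2.
- by have := L1 H1; have := R2 H2; nra.
- have := L2 H1; move/eqP/rk_inj in H2; subst d.
  by move: E3 E4 zy; rewrite /y minxx !line_at_right ?mono //; nra.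
- by have := L2 H1; have := R1 H2; nra.
- by rewrite H1 H2 orbT.
Qed.
End ConvexChain.

(** * Transport to the geometric graphs *)

Section Transport.
Variables (R : realType) (V : finType) (pt : V -> R * R) (E : {set V * V}).
Variables (n : nat) (s : nat -> bool).
Notation W := ('I_n.+2 * 'I_n.+2)%type.
Variable psi : V * V -> W.
Hypothesis psi_inj : {in E &, injective psi}.
Hypothesis cross_ecr : {in E &, forall e f, e != f ->
  edges_cross pt e f -> ecross s (psi e) (psi f)}.
Hypothesis eup_cross : {in E &, forall e f, ecross_up s (psi e) (psi f) ->
  edges_cross pt e f /\ (edge_slope pt e < edge_slope pt f)%R}.
Notation F := (psi @: E).

Lemma mem_psi (T : {set V * V}) e : T \subset E -> e \in E ->
  (psi e \in psi @: T) = (e \in T).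
Proof.
move=> TE eE; apply/imsetP/idP => [[f fT /psi_inj -> //]|eT]; last by exists e.
exact: (subsetP TE).
Qed.

Lemma psi_setD1 (T : {set V * V}) e : T \subset E -> e \in E ->
  psi @: (T :\ e) = (psi @: T) :\ psi e.
Proof.
move=> TE eE; apply/setP => g; rewrite in_setD1; apply/imsetP/andP.
  case=> f /setD1P[fe fT] ->; split; last exact: imset_f.
  by apply: contraNneq fe => /psi_inj -> //; apply: (subsetP TE).
case=> ge /imsetP[f fT gf]; exists f => //; rewrite in_setD1 fT andbT.
by apply: contraNneq ge => <-; rewrite gf.
Qed.

Lemma psi_set_inj (T T' : {set V * V}) : T \subset E -> T' \subset E ->
  psi @: T = psi @: T' -> T = T'.
Proof.
move=> TE TE' ET; apply/setP => e; have [eE|eE] := boolP (e \in E).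
  by rewrite -(mem_psi TE) // ET mem_psi.
by apply/idP/idP => [/(subsetP TE)|/(subsetP TE')]; rewrite (negPf eE).
Qed.

Lemma noncrossing_psi (T : {set V * V}) : T \subset E ->
  noncrossing pt T <-> ncross s (psi @: T).
Proof.
move=> TE; split=> [H|/ncrossP H].
  apply/ncrossP => _ _ /imsetP[e eT ->] /imsetP[f fT ->].
  have eE := subsetP TE _ eT; have fE := subsetP TE _ fT.
  have [->|ef] := eqVneq e f; first by rewrite ecrossxx.
  apply/negP => /orP[] /eup_cross[//|//|c _]; first exact: (H e f).
  by apply: (H f e) => //; rewrite eq_sym.
move=> e f eT fT ef c; have := H _ _ (imset_f psi eT) (imset_f psi fT).
by rewrite cross_ecr //; apply: (subsetP TE).
Qed.

Lemma max_noncrossing_psi (T : {set V * V}) : T \subset E ->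
  max_noncrossing pt E T = max_ncross s F (psi @: T).
Proof.
move=> TE; apply/maxsetP/max_ncrossP => [[/andP[_ /asboolP ncT] M]|[_ ncT M]].
  split; [exact: imsetS|exact/noncrossing_psi|].
  move=> _ /imsetP[e eE ->] H; rewrite mem_psi //.
  have TE' : e |: T \subset E by rewrite subUset sub1set eE.
  rewrite -(M (e |: T)) ?setU11 ?subsetUr // TE' /=;
    apply/asboolP/noncrossing_psi => //.
  rewrite imsetU1; apply/ncrossP => g h /setU1P[->|gT] /setU1P[->|hT].
  - by rewrite ecrossxx.
  - exact: H.
  - by rewrite ecrossC; apply: H.
  - by have /(noncrossing_psi TE)/ncrossP := ncT; apply.
split; first by rewrite TE; apply/asboolP/noncrossing_psi.
move=> B /andP[BE /asboolP/(noncrossing_psi BE) ncB] TB.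
apply/eqP; rewrite eqEsubset TB andbT; apply/subsetP => e eB.
have eE := subsetP BE _ eB; rewrite -(mem_psi TE) //; apply: M;
  first exact: imset_f.
move=> _ /imsetP[f fT ->]; apply: (ncrossP _ _ ncB); apply: imset_f => //.
exact: (subsetP TB).
Qed.

Lemma mnc_sub (t : mnc pt E) : val t \subset E.
Proof. by case: t => T /= /maxsetP[/andP[]]. Qed.

Lemma max_ncross_val (t : mnc pt E) : max_ncross s F (psi @: val t).
Proof. by rewrite -max_noncrossing_psi ?mnc_sub //; case: t. Qed.

Lemma mnc_of (X : {set W}) : max_ncross s F X -> {t : mnc pt E | psi @: val t = X}.
Proof.
move=> mX; pose T := [set e in E | psi e \in X].
have TE : T \subset E by apply/subsetP => e; rewrite inE => /andP[].
have TX : psi @: T = X.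
  apply/setP => g; apply/imsetP/idP => [[e]|gX];
    first by rewrite inE => /andP[_ ?] ->.
  have /max_ncrossP[/subsetP/(_ _ gX)/imsetP[e eE ge] _ _] := mX.
  by exists e => //; rewrite inE eE -ge.
have mT : max_noncrossing pt E T by rewrite max_noncrossing_psi // TX.
by exists (Sub T mT); rewrite SubK.
Qed.

Lemma val_inj_psi (t t' : mnc pt E) : psi @: val t = psi @: val t' -> t = t'.
Proof. by move=> H; apply/val_inj/psi_set_inj; rewrite ?mnc_sub. Qed.

(** The exchanged edges cross by [up_flip_ecross], so comparing their slopes decides the direction
    of [ecross_up]. *)
Lemma increasing_flip_psi (t t' : mnc pt E) :
  increasing_flip t t' = flip_in s F (psi @: val t) (psi @: val t').
Proof.
have tE := subsetP (mnc_sub t); have tE' := subsetP (mnc_sub t').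
rewrite /flip_in !max_ncross_val /=; apply/exists_inP/exists_inP.
- case=> e et /exists_inP[f ft /and3P[ef /eqP Eef lt]].
  exists (psi e); first exact: imset_f.
  apply/exists_inP; exists (psi f); first exact: imset_f.
  have nef : psi e != psi f by apply: contraNneq ef => /psi_inj ->; auto.
  have Epsi : psi @: val t :\ psi e = psi @: val t' :\ psi f.
    by rewrite -!psi_setD1 ?mnc_sub ?Eef; auto.
  rewrite nef Epsi eqxx /=.
  have := up_flip_ecross (max_ncross_val t) (max_ncross_val t') (imset_f psi et)
    (imset_f psi ft) Epsi nef.
  case/orP => // /eup_cross[||_]; [by auto|by auto|].
  by move/(lt_trans lt); rewrite ltxx.
- case=> _ /imsetP[e et ->] /exists_inP[_ /imsetP[f ft ->] /and3P[ef /eqP Eef u]].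
  exists e => //; apply/exists_inP; exists f => //; apply/and3P; split.
  + by apply: contraNneq ef => ->.
  + apply/eqP/psi_set_inj; rewrite ?psi_setD1 ?Eef ?mnc_sub; auto.
    * by apply: subset_trans (mnc_sub t); exact: subD1set.
    * by apply: subset_trans (mnc_sub t'); exact: subD1set.
  + by have [] := eup_cross (tE _ et) (tE' _ ft) u.
Qed.

(** All sets on a path of [flip_in] are maximal, hence images by [mnc_of], and the path lifts. *)
Lemma flip_le_psi (t t' : mnc pt E) :
  flip_le t t' = connect (flip_in s F) (psi @: val t) (psi @: val t').
Proof.
apply/connectP/connectP => -[p].
  elim: p t => [|x p IH] t /=; first by move=> _ ->; exists [::].
  case/andP; rewrite increasing_flip_psi => fl /IH H /H[q pq Eq].
  by exists (psi @: val x :: q); rewrite //= fl.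
elim: p t => [|x p IH] t /=.
  by move=> _ /esym/val_inj_psi ->; exists [::].
case/andP => fl; have mxx : max_ncross s F x by case/and3P: fl.
have [y Ey] := mnc_of mxx; rewrite -Ey => pth /(IH _ pth)[q pq Eq].
by exists (y :: q); rewrite //= increasing_flip_psi Ey fl.
Qed.
End Transport.

(** * Labels, ranks and signs of the vertices *)

Section Labels.
Variable n : nat.
Implicit Types (v : vertex n) (A : {set vertex n}).

Lemma label_le v : label v <= n.+1.
Proof. by case: v => k; [exact: ltnW (ltn_ord k)|exact: ltn_ord]. Qed.

Lemma min_label_le A v : v \in A -> min_label A <= label v.
Proof.
move=> vA; rewrite /min_label -minEnat -leEnat.
exact: (bigmin_le_cond n.+1 (@label n) vA).
Qed.

Lemma min_label_mem A : A != set0 -> exists2 v, v \in A & label v = min_label A.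
Proof.
case/set0Pn => v vA; case: (@arg_minnP _ v (mem A) (@label n) vA) => u uA umin.
exists u => //; apply/eqP; rewrite eqn_leq min_label_le // andbT.
(* The default [n.+1] of the minimum is at least every label. *)
rewrite /min_label; elim/big_rec: _ => [|w m wA um]; first exact: label_le.
by rewrite leq_min um umin.
Qed.

Lemma max_label_ge A v : v \in A -> label v <= max_label A.
Proof. by move=> vA; exact: leq_bigmax_cond. Qed.

Lemma max_label_mem A : A != set0 -> exists2 v, v \in A & label v = max_label A.
Proof.
rewrite -card_gt0 => /(eq_bigmax_cond (@label n))[v vA E]; by exists v.
Qed.

Lemma rank_inj : injective (@rank n).
Proof.
by move=> [k|k] [l|l] /= H; try (by congr (_ _); apply: val_inj => /=; lia); lia.
Qed.

(** Extends [eps], shifted by one, to all numbers; the labels [0] and [n+1] of the extreme vertices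
    get the value [false]. *)
Definition sign (eps : 'I_n -> bool) (k : nat) :=
  [exists i : 'I_n, (i.+1 == k) && eps i].

Lemma sign_eps eps (i : 'I_n) : sign eps i.+1 = eps i.
Proof.
apply/existsP/idP => [[j /andP[/eqP[/val_inj ->]]]//|ei].
by exists i; rewrite eqxx.
Qed.

Lemma black_inl A v : A \subset black_vertices n -> v \in A -> exists i, v = inl i.
Proof. by move=> /subsetP H /H /imsetP[i _ ->]; exists i. Qed.

Lemma white_inr A v : A \subset white_vertices n -> v \in A -> exists i, v = inr i.
Proof. by move=> /subsetP H /H /imsetP[i _ ->]; exists i. Qed.
End Labels.

Section Polygons.
Variables (R : realType) (n : nat) (eps : 'I_n -> bool).
Notation s := (sign eps).

(* [uphalf] recovers the label of a vertex from its rank. *)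
Lemma P_sides (p : vertex n -> R * R) : is_P_polygon eps p ->
  forall v, v != inl ord0 -> v != inr ord_max ->
  (if s (uphalf (rank v)) then @above_line R else @below_line R)
    (p (inl ord0)) (p (inr ord_max)) (p v).
Proof.
move=> [_ _ H] v v0 vm.
have [k kv] : exists k : 'I_n, label v = k.+1.
  case: v v0 vm => k /= k0 km.
    have kn : k.-1 < n.
      have: k != ord0 by apply: contraNneq k0 => ->.
      by rewrite -val_eqE /=; case: k {k0 km} => -[|k] //=; rewrite ltnS.
    exists (Ordinal kn) => /=; rewrite prednK // lt0n.
    by apply: contraNneq k0 => k0; apply/eqP; congr inl; exact: val_inj.
  have kn : k < n.
    have: k != ord_max by apply: contraNneq km => ->.
    by rewrite -val_eqE /= neq_ltn => /orP[//|]; rewrite ltnNge -ltnS ltn_ord.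
  by exists (Ordinal kn).
have -> : uphalf (rank v) = label v.
  by case: (v) => i /=; rewrite ?uphalf_double ?doubleK.
by have := H k v kv; rewrite kv sign_eps.
Qed.

Lemma square_sides (q : 'I_n.+2 -> R * R) : is_square_polygon eps q ->
  forall v : 'I_n.+2, v != ord0 -> v != ord_max ->
  (if s v then @above_line R else @below_line R) (q ord0) (q ord_max) (q v).
Proof.
move=> [_ _ H] v v0 vm.
have vn : v.-1 < n.
  move: v0 vm; rewrite -!val_eqE /=; have := ltn_ord v; lia.
have vE : v = (Ordinal vn).+1 :> nat by rewrite /= prednK // lt0n; exact: v0.
by have := H (Ordinal vn) v vE; rewrite {2}vE sign_eps.
Qed.

Lemma square_cross (q : 'I_n.+2 -> R * R) : is_square_polygon eps q ->
  {in polygon_edges n &, forall e f, e != f -> edges_cross q e f -> ecross s e f} /\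
  {in polygon_edges n &, forall e f, ecross_up s e f ->
    edges_cross q e f /\ (edge_slope q e < edge_slope q f)%R}.
Proof.
move=> Hq; have sides := square_sides Hq; have [cv mono _] := Hq.
have first_min (v : 'I_n.+2) : (ord0 : 'I_n.+2) <= v by [].
have last_max (v : 'I_n.+2) : v <= (ord_max : 'I_n.+2) by rewrite -ltnS.
split=> [[a b] [c d]|[a b] [c d]]; rewrite !inE /= => ab cd.
  move=> ne c0.
  exact: (segments_cross_up (rk := val)
    cv mono val_inj first_min last_max sides ab cd ne c0).
move=> u.
exact: (cross_up_segments (rk := val)
  cv mono val_inj first_min last_max sides ab cd u).
Qed.

(** A black rank [2c] is less than a white rank [2b+1] exactly when [c < b+1], which compares the
    labels. *)
Lemma cross_up_rank (a b c d : 'I_n.+1) :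
  cross_up (fun k => s (uphalf k))
    (rank (inl a : vertex n)) (rank (inr b : vertex n))
    (rank (inl c : vertex n)) (rank (inr d : vertex n)) =
  cross_up s a b.+1 c d.+1.
Proof.
rewrite /cross_up /above_l /below_r /= !doubleK !uphalf_double !ltnS !ltn_double.
by rewrite ![_.*2 <= _]leq_double.
Qed.

Lemma tree_cross (p : vertex n -> R * R) (I J : {set vertex n}) :
  is_P_polygon eps p -> I \subset black_vertices n -> J \subset white_vertices n ->
  {in tree_edges I J &, forall e f, e != f -> edges_cross p e f ->
     cross s (label e.1) (label e.2) (label f.1) (label f.2)} /\
  {in tree_edges I J &, forall e f,
    cross_up s (label e.1) (label e.2) (label f.1) (label f.2) ->
    edges_cross p e f /\ (edge_slope p e < edge_slope p f)%R}.
Proof.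
move=> Hp IB JW; have sides := P_sides Hp; have [cv mono _] := Hp.
have first_min (v : vertex n) : rank (inl ord0 : vertex n) <= rank v by [].
have last_max (v : vertex n) : rank v <= rank (inr ord_max : vertex n).
  have kn (k : 'I_n.+1) : k.*2 <= n.*2 by rewrite leq_double -ltnS.
  by case: v => k; rewrite /rank /= ?ltnS ?leqW // kn.
have edgeP e : e \in tree_edges I J ->
  exists a b, [/\ e.1 = inl a, e.2 = inr b & rank e.1 < rank e.2].
  rewrite inE => /and3P[/(black_inl IB)[a ea] /(white_inr JW)[b eb]].
  by rewrite ea eb /= => ab; exists a, b; split=> //; rewrite ltnS leq_double -ltnS.
split=> -[a b] [c d] /edgeP[i [j [/= -> -> ab]]] /edgeP[k [l [/= -> -> cd]]].
  move=> ne c0; rewrite /cross -!cross_up_rank.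
  exact: (segments_cross_up (rk := @rank n)
    cv mono (@rank_inj n) first_min last_max sides ab cd ne c0).
rewrite -cross_up_rank => u.
exact: (cross_up_segments (rk := @rank n)
  cv mono (@rank_inj n) first_min last_max sides ab cd u).
Qed.
End Polygons.

(** * The isomorphism onto an interval *)

Lemma label_inj n (A : {set vertex n}) :
  (A \subset black_vertices n) || (A \subset white_vertices n) ->
  {in A &, injective (@label n)}.
Proof.
case/orP => H u v.
  by move=> /(black_inl H)[i ->] /(black_inl H)[j ->] /= /val_inj ->.
by move=> /(white_inr H)[i ->] /(white_inr H)[j ->] /= [/val_inj ->].
Qed.

Theorem theorem2p8 (R : realType) (n : nat) (eps : 'I_n -> bool)
    (p : vertex n -> R * R) (q : 'I_n.+2 -> R * R) (I J : {set vertex n}) :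
  1 <= n ->
  is_P_polygon eps p ->
  is_square_polygon eps q ->
  I \subset black_vertices n -> J \subset white_vertices n ->
  I != set0 -> J != set0 ->
  min_label I < min_label J -> max_label I < max_label J ->
  isomorphic_to_interval (@tree_le n R p I J) (@cambrian_le n R q).
Proof.
move=> _ Hp Hq IB JW I0 J0 minIJ maxIJ.
pose s := sign eps.
pose Ib k := [exists v in I, label v == k].
pose Jb k := [exists v in J, label v == k].
have IbP v : v \in I -> Ib (label v) by move=> vI; apply/exists_inP; exists v.
have JbP v : v \in J -> Jb (label v) by move=> vJ; apply/exists_inP; exists v.
pose mu := min_label I; pose M := max_label J.
have I_mu : Ib mu by rewrite /mu; have [v vI <-] := min_label_mem I0; exact: IbP.
have J_M : Jb M by rewrite /M; have [v vJ <-] := max_label_mem J0; exact: JbP.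
have I_ge i : Ib i -> mu <= i.
  by case/exists_inP => v vI /eqP <-; exact: min_label_le.
have J_gt j : Jb j -> mu < j.
  by case/exists_inP => v vI /eqP <-; apply: leq_trans minIJ (min_label_le vI).
have J_le j : Jb j -> j <= M.
  by case/exists_inP => v vI /eqP <-; exact: max_label_ge.
have I_lt i : Ib i -> i < M.
  by case/exists_inP => v vI /eqP <-; apply: leq_ltn_trans (max_label_ge vI) maxIJ.
have M_le : M <= n.+1.
  by rewrite /M; have [v _ <-] := max_label_mem J0; exact: label_le.
pose E := tree_edges I J; pose F := merged_edges n s Ib Jb.
(* Merge the left label only; both labels are at most [n+1], so [inord] loses nothing. *)
pose psi (e : vertex n * vertex n) : 'I_n.+2 * 'I_n.+2 :=
  (inord (phi s Ib Jb (label e.1)), inord (label e.2)).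
have psi1 e : (psi e).1 = phi s Ib Jb (label e.1) :> nat.
  by rewrite inordK // ltnS (leq_trans (phi_le _ _ _ _)) ?label_le.
have psi2 e : (psi e).2 = label e.2 :> nat by rewrite inordK // ltnS label_le.
have EP e : e \in E -> [/\ e.1 \in I, e.2 \in J & label e.1 < label e.2].
  by rewrite inE => /and3P.
have psi_inj : {in E &, injective psi}.
  move=> [a b] [c d] /EP[/= aI bJ ab] /EP[/= cI dJ cd] Eq.
  have := psi1 (a, b); have := psi2 (a, b); rewrite Eq psi1 psi2 /= => E2 E1.
  congr pair; first by apply: (label_inj (A := I));
    rewrite ?IB // (phi_inj _ _ E1) ?IbP.
  by apply: (label_inj (A := J)); rewrite ?JW ?orbT.
have eup_psi e f : e \in E -> f \in E ->
    ecross_up s (psi e) (psi f) =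
      cross_up s (label e.1) (label e.2) (label f.1) (label f.2).
  move=> /EP[e1 e2 e12] /EP[f1 f2 f12].
  by rewrite /ecross_up !psi1 !psi2 cross_up_phi ?IbP ?JbP.
have psiE : psi @: E = F.
  apply/setP => g; apply/imsetP/(merged_edgesP s Jb I_lt M_le).
    case=> e /EP[e1 e2 e12] ->; exists (label e.1).
    by rewrite psi1 psi2 IbP ?JbP.
  case=> i [/exists_inP[v vI /eqP vi] Ei /exists_inP[w wJ /eqP wj] ig].
  exists (v, w); first by rewrite inE vI wJ vi wj.
  by rewrite [g]surjective_pairing /psi /= vi wj Ei !inord_val.
have [pc ps] := tree_cross Hp IB JW; have [qc qs] := square_cross Hq.
have ppc : {in E &, forall e f, e != f -> edges_cross p e f ->
  ecross s (psi e) (psi f)}.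
  move=> e f eE fE ne c; have /orP[u|u] := pc e f eE fE ne c; apply/orP;
    [left|right];
    by rewrite -[cross_up _ _ _ _ _]/(ecross_up s _ _) eup_psi.
have pps : {in E &, forall e f, ecross_up s (psi e) (psi f) ->
    edges_cross p e f /\ (edge_slope p e < edge_slope p f)%R}.
  by move=> e f eE fE; rewrite eup_psi //; exact: ps.
have [C [CE Cnc CF Cmax hC]] := frame_exists s Jb I_lt M_le.
have bl := block I_mu J_M I_ge J_gt J_le I_lt M_le.
have FE : F \subset polygon_edges n := merged_edges_sub s Jb I_lt M_le.
have FX : exchange s F := merged_edges_exchange I_lt M_le.
have blk : {in polygon_edges n, forall e : 'I_n.+2 * 'I_n.+2, e \notin F ->
  {in C, forall c, ~~ ecross s e c} -> (exists2 f, f \in F & ecross s e f) ->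
  (forall t, max_ncross s F t -> exists2 g, g \in t & ecross_up s g e) \/
  (forall t, max_ncross s F t -> exists2 g, g \in t & ecross_up s e g)}.
  move=> e eE eF eC; apply: bl => // c cH; apply: eC; exact: (subsetP hC).
(* Triangulations are transported along the identity, their labels being the vertices themselves. *)
have id_inj : {in polygon_edges n &, injective (@id ('I_n.+2 * 'I_n.+2))} by [].
have mxp (t : tree p I J) : max_ncross s F (psi @: val t).
  by rewrite -psiE; exact: (max_ncross_val psi_inj ppc pps t).
have leP (t t' : tree p I J) : tree_le t t' =
  connect (flip_in s F) (psi @: val t) (psi @: val t').
  by rewrite -psiE; exact: (flip_le_psi psi_inj ppc pps).
have leQ (z z' : triangulation q) :
    cambrian_le z z' = connect (flip_in s (polygon_edges n)) (val z) (val z').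
  by have := flip_le_psi id_inj qc qs z z'; rewrite !imset_id.
have mxq (z : triangulation q) : max_ncross s (polygon_edges n) (val z).
  by have := max_ncross_val id_inj qc qs z; rewrite !imset_id.
have mkq X : max_ncross s (polygon_edges n) X -> {z : triangulation q | val z = X}.
  by have := @mnc_of _ _ _ _ _ _ _ id_inj qc qs X; rewrite imset_id => H /H[z];
    rewrite imset_id; exists z.
have mxU X : max_ncross s F X ->
  max_ncross s (polygon_edges n) (X :|: C) :=
    @max_ncross_setU _ _ _ _ FE CE Cnc CF Cmax blk X.
(* The ends of the interval come from the least and the greatest tree. *)
have [a aE] := mkq _ (mxU _ (max_ncross_min_tree FE FX)).
have [b bE] := mkq _ (mxU _ (max_ncross_max_tree FE FX)).
have fP (t : tree p I J) :
    {z : {z : triangulation q | cambrian_le a z && cambrian_le z b} |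
      val (val z) = psi @: val t :|: C}.
  have [z zE] := mkq _ (mxU _ (mxp t)).
  have zab : cambrian_le a z && cambrian_le z b.
    rewrite !leQ aE bE zE.
    by rewrite (bot_connect FE FX CE Cnc CF Cmax blk (mxp t))
      (top_connect FE FX CE Cnc CF Cmax blk (mxp t)).
  by exists (exist _ z zab).
exists a, b, (fun t => sval (fP t)); split; last first.
  move=> t t' /=; rewrite leQ leP !(svalP (fP _)).
  apply/idP/idP;
    first exact: (connect_setU_inv FE FX CE Cnc CF Cmax blk (mxp t) (mxp t')).
  exact: connect_setU.
have finj : injective (fun t => sval (fP t)).
  move=> t t' H; have := svalP (fP t); rewrite H (svalP (fP t')) => Eq.
  apply: (val_inj_psi psi_inj).
  by rewrite -(setU_sub CF (mxp t)) -Eq (setU_sub CF (mxp t')).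
(* A triangulation in the interval lies in the union of [F] and [C], and its trace on [F] is the
   image of the required tree. *)
have fsurj z : {t | sval (fP t) = z}.
  have /andP[az zb] := valP z; rewrite !leQ aE bE in az zb.
  have mz := mxq (val z).
  have [mt Tz] :=
    max_ncross_trace FE CE Cnc CF mz
      (interval_sub FE FX CE Cnc CF Cmax blk mz az zb).
  have mt' : max_ncross s (psi @: E) (val (val z) :&: F) by rewrite psiE.
  have [t tE] := mnc_of psi_inj ppc pps mt'.
  by exists t; apply/val_inj/val_inj; rewrite (svalP (fP t)) tE.
exists (fun z => sval (fsurj z)) => [t|z].
  by apply: finj; rewrite (svalP (fsurj _)).
exact: svalP (fsurj z).
Qed.
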